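(* Assume $\delta>0$. Let $k\in\mathbb N_0$ and let $\boldsymbol v_{\tau h}\in Y_\tau^k(I)\otimes\boldsymbol V_h$ satisfy $$\max_{0\le\ell\le k}\ \max_{n=1,\dots,N}\|\partial_t^\ell\boldsymbol v_{\tau h}\|_{L^\infty(I_n;\boldsymbol W^{1,\infty}(\Omega))}\le A_k.$$ For $\boldsymbol z_{\tau h}\in Y_\tau^k(I)\otimes\boldsymbol V_h$ define on each $I_n$ $$\phi_{\mathrm{conv}}(t)=\bigl(\boldsymbol v_{\tau h}(t)\otimes\boldsymbol v_{\tau h}(t),\nabla\boldsymbol z_{\tau h}(t)\bigr)_{L^2(\Omega)},\qquad \phi_{\mathrm{visc}}(t)=\bigl(\boldsymbol S(\boldsymbol D\boldsymbol v_{\tau h}(t)),\boldsymbol D\boldsymbol z_{\tau h}(t)\bigr)_{L^2(\Omega)},$$ $$\mathcal C_n=\int_{I_n}\phi_{\mathrm{conv}}(t)\,dt,\quad \mathcal V_n=\int_{I_n}\phi_{\mathrm{visc}}(t)\,dt,\quad \mathcal C_n^{\mathrm{GR}}=Q_n(\phi_{\mathrm{conv}}),\quad \mathcal V_n^{\mathrm{GR}}=Q_n(\phi_{\mathrm{visc}}).$$ Then there exists $B_k=B_k(A_k,p,\nu_\infty,\delta)$ such that, for all $\boldsymbol z_{\tau h}\in Y_\tau^k(I)\otimes\boldsymbol V_h$, $$\Bigl|\sum_{n=1}^N(\mathcal C_n-\mathcal C_n^{\mathrm{GR}})\Bigr|+\Bigl|\sum_{n=1}^N(\mathcal V_n-\mathcal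 V_n^{\mathrm{GR}})\Bigr|\le B_k\,\tau^{k+1}\,\|\boldsymbol z_{\tau h}\|_{L^2(I;\boldsymbol H^1(\Omega))}.$$
   Context: $\Omega\subset\mathbb R^d$, $d\in\{2,3\}$, is a fixed bounded Lipschitz domain, $I=(0,T)$ with $T$ fixed, $0=t_0<t_1<\dots<t_N=T$, $I_n=(t_{n-1},t_n]$, $\tau_n=t_n-t_{n-1}$, $\tau=\max_n\tau_n$. $Y_\tau^k(I)$ is the space of functions $I\to\mathbb R$ whose restriction to each $I_n$ is a polynomial of degree at most $k$ (no continuity across time steps). $\boldsymbol V_h\subset\boldsymbol H^1(\Omega)$ is a conforming piecewise polynomial finite element space on a shape-regular mesh of $\Omega$. $\boldsymbol D\boldsymbol v=\tfrac12(\nabla\boldsymbol v+(\nabla\boldsymbol v)^\top)$ and $|\cdot|$ is the Frobenius norm. The stress law is $\boldsymbol S(\boldsymbol A)=\bigl(\nu_\infty+\nu(\delta^2+|\boldsymbol A|^2)^{(p-2)/2}\bigr)\boldsymbol A$ for $\boldsymbol A\in\mathbb R^{d\times d}_{\mathrm{sym}}$, with $1<p<2$, $\nu_\infty\ge0$, $\nu>0$, $\delta>0$ fixed. $Q_n$ is the right-sided $(k+1)$-point Gauss-Radau quadrature rule on $I_n$: its nodes include the right endpoint $t_n$ and it is exact for polynomials of degree at most $2k$ on $I_n$. $\Omega$, $d$, $T$, $\nu$ and $k$ are regarded as fixed data in the constants. *)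

(* Defs.v *)
From HB Require Import structures.
From mathcomp Require Import all_boot all_order all_algebra.
From mathcomp Require Import all_classical all_reals all_analysis.
From mathcomp Require Import ess_sup_inf.
(* The notations of mpoly clash with those of mathcomp-analysis. *)
From mathcomp Require Import (canonicals, coercions) mpoly.

Set Implicit Arguments.
Unset Strict Implicit.
Unset Printing Implicit Defensive.

Import Order.TTheory GRing.Theory Num.Theory.
Import numFieldNormedType.Exports.

Local Open Scope classical_set_scope.
Local Open Scope ring_scope.

Definition measure_rV_display : measure_display -> measure_display.
Proof. exact. Qed.

(* ['rV[T]_n] carries the sigma-algebra generated by the coordinates, as
   [n.-tuple T] does in the library. *)
Section measurable_rV.
Context {d} {T : measurableType d}.
Variable n : nat.

Let coord : 'I_n -> 'rV[T]_n -> T := fun i x => x ord0 i.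

Let rV_set0 : g_sigma_preimage coord set0.
Proof. exact: sigma_algebra0. Qed.

Let rV_setC A : g_sigma_preimage coord A -> g_sigma_preimage coord (~` A).
Proof. exact: sigma_algebraC. Qed.

Let rV_bigcup (F : _^nat) : (forall i, g_sigma_preimage coord (F i)) ->
  g_sigma_preimage coord (\bigcup_i (F i)).
Proof. exact: sigma_algebra_bigcup. Qed.

HB.instance Definition _ := @isMeasurable.Build (measure_rV_display d)
  'rV[T]_n (g_sigma_preimage coord) rV_set0 rV_setC rV_bigcup.

End measurable_rV.

Section lebesgue_rV_cons.
Context {R : realType} (n : nat).
Local Notation T := (measurableTypeR R).
Variable mu : {sigma_finite_measure set 'rV[T]_n -> \bar R}.

Definition cons_rV (u : T * 'rV[T]_n) : 'rV[T]_n.+1 :=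
  \row_(i < n.+1) oapp (u.2 ord0) u.1 (unlift ord0 i).

Lemma measurable_coord_rV m (i : 'I_m) :
  measurable_fun [set: 'rV[T]_m] (fun x : 'rV[T]_m => x ord0 i : T).
Proof.
move=> _ Y mY; rewrite setTI; apply: sub_sigma_algebra => /=.
rewrite -bigcup_seq/=; exists i => /=; first by rewrite mem_index_enum.
by exists Y => //; rewrite setTI.
Qed.

Lemma measurable_cons_rV : measurable_fun [set: T * 'rV[T]_n] cons_rV.
Proof.
move=> _ Y; rewrite setTI; move: Y; apply: smallest_sub.
  split=> [|A mA|F mF].
  - by rewrite /= preimage_set0.
  - by rewrite /= setTD preimage_setC; exact: measurableC.
  - by rewrite /= preimage_bigcup; exact: bigcup_measurable.
rewrite -bigcup_seq => A [i _ [B mB <-]] /=; rewrite setTI.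
rewrite (_ : _ @^-1` _ =
    (fun u : T * 'rV[T]_n => oapp (u.2 ord0) u.1 (unlift ord0 i)) @^-1` B);
  last by apply/seteqP; split=> u; rewrite /= mxE.
rewrite -[X in measurable X]setTI.
case: (unlift ord0 i) => [j|] /=.
  by apply: (measurableT_comp (measurable_coord_rV j) measurable_snd).
exact: measurable_fst.
Qed.

Definition lebesgue_rV_cons : set 'rV[T]_n.+1 -> \bar R :=
  pushforward ((@lebesgue_measure R \x mu)%E) cons_rV.

Let mpre A : measurable A -> measurable (cons_rV @^-1` A).
Proof. by move=> mA; rewrite -[X in measurable X]setTI; exact: measurable_cons_rV. Qed.

Let cons0 : lebesgue_rV_cons set0 = 0%E.
Proof. by rewrite /lebesgue_rV_cons /pushforward preimage_set0 measure0. Qed.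

Let cons_ge0 A : (0 <= lebesgue_rV_cons A)%E.
Proof. by rewrite /lebesgue_rV_cons /pushforward; exact: measure_ge0. Qed.

Let cons_sigma_additive : semi_sigma_additive lebesgue_rV_cons.
Proof.
move=> F mF tF mUF; rewrite /lebesgue_rV_cons /pushforward preimage_bigcup.
apply: measure_semi_sigma_additive => [i||]; first exact: mpre.
- apply/trivIsetP => /= i j _ _ ij; rewrite -preimage_setI.
  by move/trivIsetP : tF => /(_ _ _ _ _ ij) ->//; rewrite preimage_set0.
- by rewrite -preimage_bigcup; exact: mpre.
Qed.

HB.instance Definition _ := isMeasure.Build _ _ _
  lebesgue_rV_cons cons0 cons_ge0 cons_sigma_additive.

Definition uncons_rV (x : 'rV[T]_n.+1) : T * 'rV[T]_n :=
  (x ord0 ord0, \row_(i < n) x ord0 (lift ord0 i)).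

Lemma cons_rVK : cancel cons_rV uncons_rV.
Proof.
case=> a v; rewrite /uncons_rV mxE unlift_none /=; congr pair.
by apply/rowP => i; rewrite !mxE liftK.
Qed.

Lemma measurable_uncons_rV : measurable_fun [set: 'rV[T]_n.+1] uncons_rV.
Proof.
apply/measurable_fun_pairP; split=> /=; first exact: measurable_coord_rV.
move=> _ Y; rewrite setTI; move: Y; apply: smallest_sub.
  split=> [|A mA|F mF].
  - by rewrite /= preimage_set0.
  - by rewrite /= setTD preimage_setC; exact: measurableC.
  - by rewrite /= preimage_bigcup; exact: bigcup_measurable.
rewrite -bigcup_seq => A [i _ [B mB <-]] /=; rewrite setTI.
rewrite (_ : _ @^-1` _ = (fun x : 'rV[T]_n.+1 => x ord0 (lift ord0 i)) @^-1` B);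
  last by apply/seteqP; split=> x; rewrite /= mxE.
by rewrite -[X in measurable X]setTI; exact: measurable_coord_rV.
Qed.

Let cons_sigma_finite : sigma_finite setT lebesgue_rV_cons.
Proof.
have /sigma_finiteP[F [FT ndF Foo]] := sigma_finiteT (@lebesgue_measure R).
have /sigma_finiteP[G [GT ndG Goo]] := sigma_finiteT mu.
exists (fun i => uncons_rV @^-1` (F i `*` G i)) => [|i].
  apply/esym/seteqP; split=> // x _.
  have [i _ Fi] : (\bigcup_i F i) (uncons_rV x).1 by rewrite -FT.
  have [j _ Gj] : (\bigcup_i G i) (uncons_rV x).2 by rewrite -GT.
  exists (maxn i j) => //; split=> /=.
  - by move: Fi; exact/subsetPset/ndF/leq_maxl.
  - by move: Gj; exact/subsetPset/ndG/leq_maxr.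
have [mF Fi] := Foo i; have [mG Gi] := Goo i; split.
  rewrite -[X in measurable X]setTI; apply: measurable_uncons_rV => //.
  exact: measurableX.
rewrite /lebesgue_rV_cons /pushforward (_ : _ @^-1` _ = F i `*` G i).
  by rewrite product_measure1E// lte_mul_pinfty// ge0_fin_numE.
by apply/funext => u; rewrite -[in RHS](cons_rVK u).
Qed.

HB.instance Definition _ :=
  @Measure_isSigmaFinite.Build _ _ _ lebesgue_rV_cons cons_sigma_finite.

End lebesgue_rV_cons.

(* [R^0] is a point of mass 1, and [R^(n+1)] is identified with [R * R^n]. *)
Fixpoint lebesgue_rV (R : realType) (n : nat) :
    {sigma_finite_measure set 'rV[measurableTypeR R]_n -> \bar R} :=
  match n with
  | 0 => @dirac _ 'rV[measurableTypeR R]_0 0 R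
  | m.+1 => lebesgue_rV_cons (lebesgue_rV R m)
  end.

Lemma lebesgue_rV_box (R : realType) (n : nat) (a b : 'rV[R]_n) :
  (forall i, a ord0 i <= b ord0 i) ->
  lebesgue_rV R n
    [set x : 'rV[R]_n | forall i, a ord0 i <= x ord0 i <= b ord0 i] =
  (\prod_i (b ord0 i - a ord0 i))%:E.
Proof.
elim: n a b => [|n IH] a b ab.
  rewrite big_ord0 /= diracE mem_set.
    by [].
  by move=> /= -[].
pose B := [set x : 'rV[R]_n.+1 | forall i, a ord0 i <= x ord0 i <= b ord0 i]%classic.
change ((lebesgue_measure \x lebesgue_rV R n)%E (@cons_rV R n @^-1` B)%classic = (\prod_i (b ord0 i - a ord0 i))%:E).
pose a' := \row_i a ord0 (lift ord0 i); pose b' := \row_i b ord0 (lift ord0 i).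
pose B' := [set x : 'rV[R]_n | forall i, a' ord0 i <= x ord0 i <= b' ord0 i]%classic.
have -> : (@cons_rV R n @^-1` B = `[a ord0 ord0, b ord0 ord0] `*` B')%classic.
  apply/seteqP; split=> -[x y] /=.
    move=> h; split=> /=.
      by have := h ord0; rewrite mxE unlift_none /= in_itv.
    by move=> i; have := h (lift ord0 i); rewrite !mxE liftK.
  move=> [/=]; rewrite in_itv /= => hx hy i; rewrite mxE.
  by case: unliftP => [j ->|->] //=; have := hy j; rewrite !mxE.
have mB' : @measurable _ 'rV[measurableTypeR R]_n B'.
  rewrite (_ : B' = \bigcap_(i in [set: 'I_n]) ((fun x : 'rV[measurableTypeR R]_n => x ord0 i) @^-1` `[a' ord0 i, b' ord0 i]))%classic.
    apply: fin_bigcap_measurable => // i _.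
    rewrite -[X in measurable X]setTI. exact: measurable_coord_rV.
  apply/seteqP; split=> x /= h i; last by have := h i Logic.I; rewrite /= in_itv.
  by move=> _ /=; rewrite in_itv /=.
rewrite product_measure1E// IH; last by move=> i; rewrite !mxE.
rewrite big_ord_recl EFinM; congr (_ * _)%E; last first.
  by congr (_%:E); apply: eq_bigr => i _; rewrite !mxE.
etransitivity; first exact: (@lebesgue_measure_itv R `[a ord0 ord0, b ord0 ord0]).
rewrite /= lte_fin.
have [lt|ge] := ltP; first by rewrite EFinB.
have -> : b ord0 ord0 = a ord0 ord0 by apply/eqP; rewrite eq_le ge ab.
by rewrite subrr.
Qed.

Section vector_fields.
Context {R : realType} {d : nat}.
Local Notation E := 'rV[R]_d.
Implicit Types (Omega : set E) (u : E -> E) (G : E -> 'M[R]_d).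

(* On row vectors this is the Euclidean inner product, on matrices it is the
   Frobenius one. The norm [`|A|] of the library is the maximum norm. *)
Definition mxinner m n (A B : 'M[R]_(m, n)) : R := \sum_i \sum_j A i j * B i j.

Definition frob m n (A : 'M[R]_(m, n)) : R := Num.sqrt (mxinner A A).

(* Near each boundary point, [U] lies strictly above the graph of [gamma],
   the hyperplane orthogonal to the unit vector [e] being horizontal. *)
Definition lipschitz_boundary (U : set E) : Prop :=
  forall a, closure U a -> ~ U a ->
    exists (e : E) (gamma : E -> R),
      [/\ frob e = 1, exists c : R, c.-lipschitz gamma &
          \forall y \near a,
            U y <-> gamma (y - mxinner y e *: e) < mxinner y e].

Definition lipschitz_domain Omega : Prop :=
  [/\ open Omega, connected Omega, Omega !=set0, bounded_set Omega &
      lipschitz_boundary Omega].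

Definition partials (s : seq 'I_d) (f : E -> R) : E -> R :=
  foldr (fun j g => fun x => 'D_(delta_mx 0 j) g x) f s.

Definition smooth (f : E -> R) : Prop :=
  forall s x, differentiable (partials s f) x.

Definition test_function Omega (phi : E -> R) : Prop :=
  let supp := closure [set x | phi x != 0] in
  [/\ smooth phi, compact supp & supp `<=` Omega].

Definition weak_gradient Omega u G : Prop :=
  forall phi, test_function Omega phi -> forall i j,
    \int[lebesgue_rV R d]_(x in Omega) (u x 0 i * 'D_(delta_mx 0 j) phi x) =
    - \int[lebesgue_rV R d]_(x in Omega) (G x i j * phi x).

Definition square_integrable Omega (f : E -> R) : Prop :=
  @measurable_fun _ _ 'rV[measurableTypeR R]_d (measurableTypeR R) Omega f /\
  (\int[lebesgue_rV R d]_(x in Omega) ((f x) ^+ 2)%:E < +oo)%E.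

(* A Sobolev vector field is handled as a pair [w] made of a representative
   [w.1] of the field and a representative [w.2] of its weak gradient,
   [w.2 x i j] standing for the derivative of the [i]-th component in the
   direction [j]. Weak gradients being unique up to null sets, no integral or
   norm below depends on the choice of representatives. *)
Definition sobolev_pair : Type := ((E -> E) * (E -> 'M[R]_d))%type.
Implicit Types w : sobolev_pair.

Definition H1 Omega : set sobolev_pair := [set w : sobolev_pair |
  [/\ forall i, square_integrable Omega (fun x => w.1 x 0 i),
      forall i j, square_integrable Omega (fun x => w.2 x i j) &
      weak_gradient Omega w.1 w.2]].

Definition H1norm Omega w : R :=
  Num.sqrt (\int[lebesgue_rV R d]_(x in Omega)
              (frob (w.1 x) ^+ 2 + frob (w.2 x) ^+ 2)).

Definition Linfnorm Omega m n (F : E -> 'M[R]_(m, n)) : \bar R :=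
  ess_sup (lebesgue_rV R d) ((fun x => (frob (F x))%:E) \_ Omega).

Definition W1infnorm Omega w : \bar R :=
  maxe (Linfnorm Omega w.1) (Linfnorm Omega w.2).

(* The elements are arbitrary closed sets with Lipschitz boundary, not only
   simplices. *)
Definition mesh Omega M (K : 'I_M -> set E) : Prop :=
  [/\ closure Omega = \bigcup_i K i,
      forall i, interior (K i) !=set0 /\ K i = closure (interior (K i)),
      forall i, lipschitz_boundary (interior (K i)) &
      forall i j, i != j -> interior (K i) `&` interior (K j) = set0].

Definition shape_regular (sigma : R) M (K : 'I_M -> set E) : Prop :=
  forall i, exists (c : E) (rho : R),
    [/\ 0 < rho, forall x, frob (x - c) < rho -> K i x &
        forall x y, K i x -> K i y -> frob (x - y) <= sigma * (2 * rho)].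

Definition piecewise_polynomial (r M : nat) (K : 'I_M -> set E) u : Prop :=
  forall i c, exists2 q : mpoly.mpoly d R, (mpoly.msize q <= r.+1)%N &
    forall x, interior (K i) x -> u x 0 c = mpoly.meval (fun j => x 0 j) q.

Definition conforming_fe_space Omega (r M : nat) (K : 'I_M -> set E)
    (Vh : set sobolev_pair) : Prop :=
  [/\ Vh `<=` H1 Omega,
      Vh 0,
      forall (a : R) w w', Vh w -> Vh w' -> Vh (a *: w + w') &
      forall w, Vh w -> piecewise_polynomial r K w.1].

Definition time_grid (T : R) (N : nat) (t : nat -> R) : Prop :=
  [/\ t 0%N = 0, t N = T & forall n, (n < N)%N -> t n < t n.+1].

Definition max_step (N : nat) (t : nat -> R) : R :=
  \big[Num.max/0]_(n < N) (t n.+1 - t n).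

Definition Ytau (k N : nat) (t : nat -> R) (y : R -> R) : Prop :=
  forall n, (n < N)%N -> exists2 q : {poly R}, (size q <= k.+1)%N &
    forall s, t n < s <= t n.+1 -> y s = q.[s].

Definition Ytau_tensor (k N : nat) (t : nat -> R) (Vh : set sobolev_pair)
    (v : R -> sobolev_pair) : Prop :=
  exists (m : nat) (y : 'I_m -> R -> R) (w : 'I_m -> sobolev_pair),
    [/\ forall i, Ytau k N t (y i), forall i, Vh (w i) &
        forall s, t 0%N < s <= t N -> v s = \sum_i y i s *: w i].

(* The derivative of order [l] in time, taken pointwise in space. *)
Definition dtime (l : nat) (v : R -> sobolev_pair) (s : R) : sobolev_pair :=
  (fun x => derive1n l (fun s' => (v s').1 x) s,
   fun x => derive1n l (fun s' => (v s').2 x) s).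

Definition LinfW1infnorm Omega (J : set R) (v : R -> sobolev_pair) : \bar R :=
  ess_sup (@lebesgue_measure R) ((fun s => W1infnorm Omega (v s)) \_ J).

Definition L2H1norm Omega (J : set R) (v : R -> sobolev_pair) : R :=
  Num.sqrt (\int[@lebesgue_measure R]_(s in J) (H1norm Omega (v s) ^+ 2)).

(* The [k+1] nodes [xi] and weights [om] of the right-sided Gauss-Radau rule
   on [`]a, b]]. *)
Definition gauss_radau (k : nat) (a b : R) (xi om : 'I_k.+1 -> R) : Prop :=
  [/\ injective xi,
      forall i, a < xi i <= b,
      exists i, xi i = b &
      forall q : {poly R}, (size q <= (2 * k).+1)%N ->
        \sum_i om i * q.[xi i] =
        \int[@lebesgue_measure R]_(s in `]a, b]) q.[s]].

Definition quadrature (k : nat) (xi om : 'I_k.+1 -> R) (f : R -> R) : R :=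
  \sum_i om i * f (xi i).

Definition symgrad w : E -> 'M[R]_d := fun x => 2^-1 *: (w.2 x + (w.2 x)^T).

Definition stress (p nuinf nu delta : R) (A : 'M[R]_d) : 'M[R]_d :=
  (nuinf + nu * (delta ^+ 2 + frob A ^+ 2) `^ ((p - 2) / 2)) *: A.

Definition outer (u v : E) : 'M[R]_d := u^T *m v.

Definition L2dot Omega (F G : E -> 'M[R]_d) : R :=
  \int[lebesgue_rV R d]_(x in Omega) mxinner (F x) (G x).

Definition phi_conv Omega (v z : R -> sobolev_pair) (s : R) : R :=
  L2dot Omega (fun x => outer ((v s).1 x) ((v s).1 x)) (z s).2.

Definition phi_visc Omega (p nuinf nu delta : R) (v z : R -> sobolev_pair)
    (s : R) : R :=
  L2dot Omega (fun x => stress p nuinf nu delta (symgrad (v s) x))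
              (symgrad (z s)).

(* The quadrature error on the [n]-th time step, [t] being the time grid. *)
Definition quad_error (k : nat) (t : nat -> R) (xi om : nat -> 'I_k.+1 -> R)
    (f : R -> R) (n : nat) : R :=
  \int[@lebesgue_measure R]_(s in `]t n, t n.+1]) f s -
  quadrature (xi n) (om n) f.

End vector_fields.
Arguments sobolev_pair : clear implicits.

(* Main.v *)
Require Import Defs.
From HB Require Import structures.
From mathcomp Require Import all_boot all_order all_algebra.
From mathcomp Require Import all_classical all_reals all_analysis.
From mathcomp Require Import measurable_realfun ess_sup_inf ring lra.

Set Implicit Arguments.
Unset Strict Implicit.
Unset Printing Implicit Defensive.

Import Order.TTheory GRing.Theory Num.Theory.
Import numFieldNormedType.Exports.

Local Open Scope classical_set_scope.
Local Open Scope ring_scope.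

(* On a time step with Gauss-Radau nodes xi_j, let P F be the Lagrange interpolant
   of degree k in time of F = v (x) v or F = S(Dv) at the xi_j. The integrand
   (P F, G), with G = grad z or Dz, is a polynomial in time of degree 2k that has
   the same nodal values as (F, G), so the quadrature error is exactly the time
   integral of (F - P F, G). For almost every x the map F(., x) is a smooth
   function of polynomials in time whose derivatives are bounded by A; hence its
   derivatives up to order k+1 are bounded in terms of the data (for S(Dv) because
   delta^2 + |Dv|^2 stays away from 0), and repeated use of Rolle's theorem gives
   |F - P F| <= C tau^(k+1). Cauchy-Schwarz in space and time is replaced by
   |g| <= (lambda + g^2 / lambda) / 2, with lambda chosen after summing over all
   steps. *)

(** * Functions of time with bounded derivatives *)

(** The essential supremum in time says nothing about a single time, whereas the quadrature samples
    the integrand at finitely many nodes; moreover the null set in space could change with the time.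
    Both obstacles vanish because, at a fixed point of space, the discrete functions are polynomials
    in time: bounds at a dense set of times extend to the whole closed step. These polynomials live
    on the whole line, so they replace [v] and [z], which follow them on one half-open step only,
    wherever smoothness in time matters. The constants are produced from [A], [k], [d] and the
    stress parameters before any step is fixed, hence are the same for all grids. The inequality
    with lambda is linear in the integrals, so it passes through integration and summation without
    square roots. With K the constant times tau^(k+1), m = |Omega| T and L the norm of z, the
    outcome is K (lambda m + L^2 / lambda) / 2, and lambda = L turns it into K (m + 1) / 2 times
    L. *)

Section bounded_derivatives.
Context {R : realType}.
Variables a b : R.
Implicit Types (f g : R -> R) (C D : R) (m : nat).

(* Derivatives exist on the whole line, the bounds hold on [a, b] only:
   [deriv_bounded] bounds the m-th derivative, [derivs_bounded] all those of
   order at most m. *)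
Fixpoint deriv_bounded (C : R) (m : nat) (f : R -> R) : Prop :=
  if m is m'.+1 then exists2 f', (forall s : R, is_derive s (1 : R) f (f' s)) &
    deriv_bounded C m' f'
  else forall s, a <= s <= b -> `|f s| <= C.

Fixpoint derivs_bounded (C : R) (m : nat) (f : R -> R) : Prop :=
  (forall s, a <= s <= b -> `|f s| <= C) /\
  if m is m'.+1 then exists2 f', (forall s : R, is_derive s (1 : R) f (f' s)) &
    derivs_bounded C m' f'
  else True.

Lemma derivs_bounded0 C m f : derivs_bounded C m f ->
  forall s, a <= s <= b -> `|f s| <= C.
Proof. by case: m => [|m] []. Qed.

Lemma derivs_boundedW C m f : derivs_bounded C m.+1 f -> derivs_bounded C m f.
Proof.
elim: m f => [|m IH] f [f0 [f' df f'b]]; first by [].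
by split => //; exists f' => //; exact: IH.
Qed.

Lemma derivs_bounded_le C D m f : C <= D ->
  derivs_bounded C m f -> derivs_bounded D m f.
Proof.
move=> CD; elim: m f => [|m IH] f [f0 f'b]; split => //.
- by move=> s /f0 /le_trans; exact.
- by move=> s /f0 /le_trans; exact.
- by case: f'b => f' df f'b; exists f' => //; exact: IH.
Qed.

Lemma derivs_bounded_deriv_bounded C m f :
  derivs_bounded C m f -> deriv_bounded C m f.
Proof.
elim: m f => [|m IH] f [f0 //] [f' df f'b].
by exists f' => //; exact: IH.
Qed.

Lemma derivs_bounded_cst C m c : `|c| <= C -> derivs_bounded C m (cst c).
Proof.
elim: m c => [|m IH] c cC; split => //.
exists (cst 0); first by move=> s; exact: is_derive_cst.
by apply: IH; rewrite normr0 (le_trans _ cC).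
Qed.

Lemma derivs_boundedD C D m f g : derivs_bounded C m f ->
  derivs_bounded D m g -> derivs_bounded (C + D) m (f + g).
Proof.
elim: m f g => [|m IH] f g [f0 f1] [g0 g1]; split.
- by move=> s sab; rewrite (le_trans (ler_normD _ _))// lerD ?f0 ?g0.
- by [].
- by move=> s sab; rewrite (le_trans (ler_normD _ _))// lerD ?f0 ?g0.
- case: f1 g1 => f' df f'b [g' dg g'b].
  by exists (f' + g') => [s|]; [exact: is_deriveD|exact: IH].
Qed.

Lemma derivs_bounded_sum C m n (f : 'I_n -> R -> R) :
  (forall i, derivs_bounded C m (f i)) ->
  derivs_bounded (n%:R * C) m (fun s => \sum_(i < n) f i s).
Proof.
elim: n f => [|n IH] f fC.
  rewrite mul0r (_ : (fun _ => _) = cst 0); last first.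
    by apply/funext => s; rewrite big_ord0.
  by apply: derivs_bounded_cst; rewrite normr0.
rewrite (_ : (fun _ => _) =
    (fun s => \sum_(i < n) f (widen_ord (leqnSn n) i) s) + f ord_max); last first.
  by apply/funext => s; rewrite big_ord_recr.
by rewrite -natr1 mulrDl mul1r; apply: derivs_boundedD => //; exact: IH.
Qed.

(** Each differentiation splits a product into two, whence the factor 2 per order. The Leibniz rule
    meets all lower derivatives of both factors, which is why the bounds are carried for every order
    up to [m]. *)
Lemma derivs_boundedM C D m f g : derivs_bounded C m f ->
  derivs_bounded D m g -> derivs_bounded (2 ^+ m * (C * D)) m (f * g).
Proof.
elim: m C D f g => [|m IH] C D f g.
  move=> [f0 _] [g0 _]; split => // s sab.
  by rewrite normrM expr0 mul1r ler_pM ?f0 ?g0.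
move=> fC gD; split.
  move=> s sab; rewrite normrM.
  have fs := derivs_bounded0 fC sab; have gs := derivs_bounded0 gD sab.
  have h1 : 1 <= 2 ^+ m.+1 :> R by rewrite exprn_ege1// ler1n.
  have h2 : `|f s| * `|g s| <= C * D by rewrite ler_pM.
  by rewrite (le_trans h2)// ler_peMl// (le_trans _ h2)// mulr_ge0.
have [_ [f' df f'b]] := fC; have [_ [g' dg g'b]] := gD.
exists (f * g' + g * f') => [s|]; first exact: is_deriveM.
rewrite exprS -mulrA mulr_natl mulr2n; apply: derivs_boundedD.
  by apply: IH => //; exact: derivs_boundedW.
by rewrite [C * D]mulrC; apply: IH => //; exact: derivs_boundedW.
Qed.

Lemma derivs_boundedZ C m c f : derivs_bounded C m f ->
  derivs_bounded (`|c| * C) m (fun s => c * f s).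
Proof.
elim: m f => [|m IH] f [f0 f1]; split.
- by move=> s sab; rewrite normrM ler_wpM2l ?f0.
- by [].
- by move=> s sab; rewrite normrM ler_wpM2l ?f0.
- case: f1 => f' df f'b; exists (fun s => c * f' s) => [s|]; last exact: IH.
  exact: is_deriveZ.
Qed.

(** Derivatives of order above [k] vanish, so bounds up to order [k] give bounds of every order [m].
    The interpolation error needs order [k + 1], one more than the data provide. *)
Lemma derivs_bounded_horner C k m (p : {poly R}) : 0 <= C ->
  (size p <= k.+1)%N ->
  (forall l s, (l <= k)%N -> a <= s <= b -> `|p^`(l).[s]| <= C) ->
  derivs_bounded C m (horner p).
Proof.
move=> C0 sp pC; have {}pC l s : a <= s <= b -> `|p^`(l).[s]| <= C.
  have [lk|kl] := leqP l k; first exact: pC.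
  by move=> _; rewrite (@derivn_poly0 _ p l) ?horner0 ?normr0// (leq_trans sp).
rewrite -[p]derivn0; elim: m 0%N => [|m IH] l; first by split => // s; exact: pC.
split; first by move=> s; exact: pC.
exists (horner p^`(l.+1)) => // s; rewrite derivnS; exact: is_derive_poly.
Qed.

Lemma deriv_boundedD C D m f g : deriv_bounded C m f ->
  deriv_bounded D m g -> deriv_bounded (C + D) m (f + g).
Proof.
elim: m f g => [|m IH] f g.
  by move=> f0 g0 s sab; rewrite (le_trans (ler_normD _ _))// lerD ?f0 ?g0.
move=> [f' df f'b] [g' dg g'b].
by exists (f' + g') => [s|]; [exact: is_deriveD|exact: IH].
Qed.

(** Used to subtract an interpolant at no cost: its lower derivatives are not controlled, but its
    derivative of order [k + 1] is zero. Hence the weaker predicate, which looks at the top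
    derivative only. *)
Lemma deriv_bounded_horner m (p : {poly R}) :
  (size p <= m)%N -> deriv_bounded 0 m (horner p).
Proof.
elim: m p => [|m IH] p sp.
  move=> s _ /=; move: sp; rewrite leqn0 size_poly_eq0 => /eqP ->.
  by rewrite horner0 normr0.
exists (horner p^`()) => [s|]; first exact: is_derive_poly.
apply: IH; have [->|p0] := eqVneq p 0; first by rewrite deriv0 size_poly0.
by rewrite -ltnS (leq_trans (lt_size_deriv p0)).
Qed.

Lemma is_derive_MVT f f' (x y : R) : (forall s : R, is_derive s (1 : R) f (f' s)) ->
  x <= y -> exists2 c, x <= c <= y & f y - f x = f' c * (y - x).
Proof.
move=> df xy; have [|c] := MVT_segment xy (fun z _ => df z).
  by apply: derivable_within_continuous => z _; exact: ex_derive.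
by rewrite in_itv /=; exists c.
Qed.

(** Rolle's theorem between consecutive zeros. The clause [z < x] is the invariant of the induction:
    the new zero lies before [y], all those found later lie after [y], so the list stays strictly
    increasing. *)
Lemma Rolle_zeros f f' (z : R) (s : seq R) :
  (forall s : R, is_derive s (1 : R) f (f' s)) ->
  path <%R z s -> all (fun x => a <= x <= b) (z :: s) ->
  (forall x, x \in z :: s -> f x = 0) ->
  exists s', [/\ size s' = size s, sorted <%R s',
    all (fun x => a <= x <= b) s' & forall x, x \in s' -> z < x /\ f' x = 0].
Proof.
move=> df; elim: s z => [|y s IH] z /=; first by exists [::].
move=> /andP[zy ys] /and3P[zab yab sab] f0.
have [||s' [s's ss' s'ab s'0]] := IH y ys.
- by rewrite /= yab.
- by move=> x xys; rewrite f0// in_cons xys orbT.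
have [||c] := Rolle zy (fun x _ => @ex_derive _ _ _ _ _ _ _ (df x)).
- by apply: derivable_within_continuous => x _; exact: ex_derive.
- by rewrite !f0// !inE eqxx ?orbT.
rewrite in_itv /= => /andP[zc cy] dfc.
have fc : f' c = 0.
  by rewrite -(@derive_val _ _ _ _ _ _ _ (df c)) (@derive_val _ _ _ _ _ _ _ dfc).
exists (c :: s'); split => /=.
- by rewrite s's.
- case: s' ss' s'0 {s's s'ab} => //= w s' -> s'0; rewrite andbT.
  by apply: lt_trans cy _; case: (s'0 w); rewrite ?inE ?eqxx.
- rewrite s'ab andbT; apply/andP; split.
    by case/andP: zab => az _; exact: le_trans (ltW zc).
  by case/andP: yab => _ yb; exact: le_trans (ltW cy) _.
- move=> x; rewrite inE => /predU1P[->//|/s'0[yx ->]].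
  by split => //; exact: lt_trans yx.
Qed.

(** By Rolle, [f'] has one zero less than [f], so induction bounds [f']; the mean value theorem from
    a zero of [f] then gains one factor [b - a]. *)
Lemma deriv_bounded_zeros C m f (z : seq R) : 0 <= C ->
  deriv_bounded C m f -> sorted <%R z -> all (fun x => a <= x <= b) z ->
  size z = m -> (forall x, x \in z -> f x = 0) ->
  forall s, a <= s <= b -> `|f s| <= C * (b - a) ^+ m.
Proof.
move=> C0; elim: m f z => [|m IH] f z.
  by move=> fb _ _ _ _ s sab; rewrite expr0 mulr1; exact: fb.
case: z => [//|z s] [f' df f'b] zs zab [sm] f0 x xab.
have [s' [s's ss' s'ab s'0]] := Rolle_zeros df zs zab f0.
have f'C : forall s, a <= s <= b -> `|f' s| <= C * (b - a) ^+ m.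
  by apply: (IH f' s') => //; [rewrite s's|move=> y /s'0[]].
have fz : f z = 0 by rewrite f0// inE eqxx.
have {}zab : a <= z <= b by case/andP: zab.
(* The mean value theorem between [z] and [x], in whichever order they lie. *)
wlog: / exists2 c, a <= c <= b & `|f x| = `|f' c| * `|x - z|.
  apply; case: (leP z x) => [zx|/ltW xz].
    have [c /andP[zc cx] E] := is_derive_MVT df zx.
    exists c; last by rewrite -normrM -E fz subr0.
    case/andP: zab => az _; case/andP: xab => _ xb.
    by rewrite (le_trans az zc) (le_trans cx xb).
  have [c /andP[xc cz] E] := is_derive_MVT df xz.
  exists c; last by rewrite distrC -normrM -E fz sub0r normrN.
  case/andP: zab => _ zb; case/andP: xab => ax _.
  by rewrite (le_trans ax xc) (le_trans cz zb).
move=> [c cab ->]; rewrite exprSr mulrA; apply: ler_pM => //; first exact: f'C.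
by case/andP: xab => ax xb; case/andP: zab => az zb; rewrite ler_norml; lra.
Qed.

End bounded_derivatives.

(** For a nonpositive exponent the power is decreasing, so [c <= g] bounds it by [c] to the power
    [r]. Differentiating lowers the exponent to [r - 1], still nonpositive, so the induction on [m]
    runs over all such [r]. [D] is fixed before the interval and [g], hence is uniform in the step
    and in the point of space. *)
Lemma derivs_bounded_powR (R : realType) (C c r : R) m : 0 < c -> r <= 0 ->
  exists2 D, 0 <= D & forall a b g, (forall s, c <= g s) ->
    derivs_bounded a b C m g -> derivs_bounded a b D m (fun s => g s `^ r).
Proof.
move=> c0; elim: m r => [|m IH] r r0.
all: have bound (g : R -> R) : (forall s, c <= g s) -> forall s, `|g s `^ r| <= c `^ r.
1,3: move=> cg s; rewrite ger0_norm ?powR_ge0// /powR !gt_eqF//;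
       last exact: lt_le_trans (cg s);
     by rewrite ler_expR ler_wnM2l// ler_ln ?posrE// (lt_le_trans c0).
  by exists (c `^ r) => [|a b g cg _]; [exact: powR_ge0|split => // s _; exact: bound].
have [|D D0 DP] := IH (r - 1); first lra.
exists (Num.max (c `^ r) (`|r| * (2 ^+ m * (D * `|C|)))) => [|a b g cg gC].
  by rewrite le_max powR_ge0.
split=> [s _|]; first by rewrite le_max bound.
have [_ [g' dg g'b]] := gC.
exists (fun s => r * (g s `^ (r - 1) * g' s)) => [s|].
  have gs : 0 < g s := lt_le_trans c0 (cg s).
  by rewrite mulrA; exact: (is_derive1_comp (is_derive1_powR r gs)).
apply: (@derivs_bounded_le _ _ _ (`|r| * (2 ^+ m * (D * `|C|)))).
  by rewrite le_max lexx orbT.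
apply: derivs_boundedZ; apply: derivs_boundedM.
  by apply: DP => //; exact: derivs_boundedW.
by apply: derivs_bounded_le g'b; exact: ler_norm.
Qed.

(** * Lagrange interpolation in time *)

Section lagrange_interpolation.
Context {R : realType}.

Lemma exists_lagrange_basis (k : nat) (xi : 'I_k.+1 -> R) : injective xi ->
  exists ell : 'I_k.+1 -> {poly R}, (forall i, (size (ell i) <= k.+1)%N) /\
    forall i j, (ell i).[xi j] = (i == j)%:R.
Proof.
move=> xiI.
pose P i : {poly R} := \prod_(j | j != i) ('X - (xi j)%:P).
have PE i : (P i).[xi i] != 0.
  rewrite horner_prod; apply/prodf_neq0 => j ji.
  by rewrite hornerXsubC subr_eq0 inj_eq// eq_sym.
exists (fun i => (P i).[xi i]^-1 *: P i); split=> [i|i j].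
  apply: leq_trans (size_scale_leq _ _) _.
  rewrite size_prod; last by move=> j _; rewrite polyXsubC_eq0.
  rewrite (eq_bigr (fun=> (2 * 1)%N)); last by move=> j _; rewrite size_XsubC.
  rewrite -big_distrr /= sum1_card (cardC1 i) card_ord mul2n -addnn.
  by rewrite subSn ?leq_addr// addnK.
rewrite hornerZ; have [<-|ij] := eqVneq i j; first by rewrite mulVf.
rewrite [X in _ * X](_ : _ = 0) ?mulr0// horner_prod (bigD1 j) 1?eq_sym //=.
by rewrite hornerXsubC subrr mul0r.
Qed.

(** The error vanishes at the [k + 1] nodes, and its derivative of order [k + 1] is that of [f], the
    interpolant having degree at most [k]. *)
Lemma interpolation_error (a b C : R) (k : nat) (xi : 'I_k.+1 -> R)
    (ell : 'I_k.+1 -> {poly R}) (f : R -> R) :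
  0 <= C -> injective xi -> (forall i, a <= xi i <= b) ->
  (forall i, (size (ell i) <= k.+1)%N) ->
  (forall i j, (ell i).[xi j] = (i == j)%:R) ->
  deriv_bounded a b C k.+1 f ->
  forall s, a <= s <= b ->
    `|f s - \sum_i (ell i).[s] * f (xi i)| <= C * (b - a) ^+ k.+1.
Proof.
move=> C0 xiI xiab sell ellxi fC.
pose P := - \sum_i f (xi i) *: ell i.
have PE x : P.[x] = - \sum_i (ell i).[x] * f (xi i).
  by rewrite hornerN horner_sum; congr (- _); apply: eq_bigr => i _; rewrite hornerZ mulrC.
have sP : (size P <= k.+1)%N.
  rewrite size_polyN (leq_trans (size_sum _ _ _))//; apply/bigmax_leqP => i _.
  exact: leq_trans (size_scale_leq _ _) _.
(* The nodes come in no particular order, while the argument by Rolle needs an increasing list. *)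
pose z := sort <=%R [seq xi i | i : 'I_k.+1].
have zE x : x \in z -> exists i, x = xi i.
  by rewrite mem_sort => /mapP[i _ ->]; exists i.
have gC : deriv_bounded a b C k.+1 (f + horner P).
  by rewrite -[C]addr0; apply: deriv_boundedD => //; exact: deriv_bounded_horner.
have H := @deriv_bounded_zeros _ a b C k.+1 (f + horner P) z C0 gC.
move=> s sab; rewrite -PE; apply: H => //.
- rewrite /z sort_lt_sorted map_inj_uniq//; exact: enum_uniq.
- by apply/allP => x /zE[i ->].
- by rewrite size_sort size_map -cardE card_ord.
- move=> x /zE[i ->]; rewrite fctE PE (bigD1 i)//= ellxi eqxx mul1r big1 ?addr0 ?subrr//.
  by move=> j ji; rewrite ellxi (negbTE ji) mul0r.
Qed.

End lagrange_interpolation.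

(** * The quadrature error of a pairing on one time step *)

Section Rintegral_sum.
Context d (X : measurableType d) (R : realType).
Variables (mu : {measure set X -> \bar R}) (D : set X) (I : Type).
Hypothesis mD : measurable D.

Lemma integrable_rsum (s : seq I) (h : I -> X -> R) :
  (forall i, mu.-integrable D (EFin \o h i)) ->
  mu.-integrable D (EFin \o (fun x => \sum_(i <- s) h i x)).
Proof.
move=> hi; rewrite (_ : _ \o _ = fun x => (\sum_(i <- s) (EFin \o h i) x)%E).
  exact: integrable_sum.
by apply/funext => x; rewrite /= -sumEFin.
Qed.

Lemma Rintegral_sum (s : seq I) (h : I -> X -> R) :
  (forall i, mu.-integrable D (EFin \o h i)) ->
  \int[mu]_(x in D) (\sum_(i <- s) h i x) =
  \sum_(i <- s) \int[mu]_(x in D) h i x.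
Proof.
move=> hi; elim: s => [|i s IH].
  under eq_Rintegral do rewrite big_nil.
  by rewrite big_nil Rintegral_cst// mul0r.
under eq_Rintegral do rewrite big_cons.
by rewrite big_cons RintegralD ?IH//; exact: integrable_rsum.
Qed.

End Rintegral_sum.

Section time_step_quadrature.
Context d (X : measurableType d) (R : realType).
Variable mu : {measure set X -> \bar R}.
Variable D : set X.
Hypothesis mD : measurable D.
Variables a b C : R.
Hypotheses (ab : a < b) (C0 : 0 <= C).
Variables (k m : nat) (F : R -> X -> R) (q : 'I_m -> {poly R}) (W : 'I_m -> X -> R).
Hypothesis FC : forall x, D x -> derivs_bounded a b C k.+1 (F ^~ x).
Hypothesis mF : forall s, a <= s <= b -> measurable_fun D (F s).
Hypothesis Wi : forall i, mu.-integrable D (EFin \o W i).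
Hypothesis sq : forall i, (size (q i) <= k.+1)%N.

Let G s x := \sum_i (q i).[s] * W i x.
Let phi s := \int[mu]_(x in D) (F s x * G s x).
(** Separation of variables: [phi] is the sum of the polynomials [q i] times these moments, so its
    regularity in time reduces to that of the [c i]. *)
Let c i s := \int[mu]_(x in D) (F s x * W i x).

Let integrable_bounded_mul (h g : X -> R) (B : R) : measurable_fun D h ->
  (forall x, D x -> `|h x| <= B) -> mu.-integrable D (EFin \o g) ->
  mu.-integrable D (EFin \o (fun x => h x * g x)).
Proof.
move=> mh hB gi.
have := integrableMr mD mh _ gi; apply.
exists B; split; first exact: num_real.
by move=> y By x Dx /=; rewrite (le_trans (hB _ Dx))// ltW.
Qed.

Let integrable_FW i s : a <= s <= b ->
  mu.-integrable D (EFin \o (fun x => F s x * W i x)).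
Proof.
move=> sab; apply: (@integrable_bounded_mul _ _ C) => //; first exact: mF.
by move=> x Dx; apply: (derivs_bounded0 (FC Dx)).
Qed.

Let integrable_G s : mu.-integrable D (EFin \o G s).
Proof.
apply: integrable_rsum => // i; exact: (integrableZl mD (q i).[s] (Wi i)).
Qed.

Let Rintegral_sum_scale (I : finType) (h : I -> X -> R) (r : I -> R) :
  (forall i, mu.-integrable D (EFin \o h i)) ->
  \int[mu]_(x in D) (\sum_i r i * h i x) = \sum_i r i * \int[mu]_(x in D) h i x.
Proof.
move=> hi; rewrite Rintegral_sum//; last first.
  by move=> i; exact: (integrableZl _ (r i) (hi i)).
by apply: eq_bigr => i _; rewrite RintegralZl.
Qed.

Let phiE s : a <= s <= b -> phi s = \sum_i (q i).[s] * c i s.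
Proof.
move=> sab; rewrite /phi /c -Rintegral_sum_scale; last first.
  by move=> i; exact: integrable_FW.
apply: eq_Rintegral => x _; rewrite /G mulr_sumr; apply: eq_bigr => i _.
by rewrite mulrCA.
Qed.

(** The first derivative in time is bounded uniformly in [x]; this makes the moments [c i]
    Lipschitz, hence continuous, and [phi] integrable in time. *)
Let F_lipschitz x s s' : D x -> a <= s <= b -> a <= s' <= b ->
  `|F s x - F s' x| <= C * `|s - s'|.
Proof.
move=> Dx; have [_ [f' df /derivs_bounded0 f'C]] := FC Dx.
wlog ss' : s s' / s <= s'.
  move=> H sab s'ab; case: (leP s s') => [|/ltW] ss'; first exact: H.
  by rewrite distrC [`|s - _|]distrC; exact: H.
move=> /andP[s1 s2] /andP[s3 s4].
have [e /andP[e1 e2] E] := is_derive_MVT df ss'.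
rewrite distrC E normrM [`|s' - _|]distrC ler_wpM2r// f'C//.
by rewrite (le_trans s1 e1) (le_trans e2 s4).
Qed.

Let c_lipschitz i s s' : a <= s <= b -> a <= s' <= b ->
  `|c i s - c i s'| <= C * (\int[mu]_(x in D) `|W i x|) * `|s - s'|.
Proof.
move=> sab s'ab; rewrite /c -RintegralB; [|exact: mD|exact: integrable_FW..].
rewrite (le_trans (le_normr_Rintegral _ _))//.
  exact: (integrableB mD (integrable_FW i sab) (integrable_FW i s'ab)).
rewrite mulrAC -RintegralZl//; last exact: integrable_norm.
apply: le_Rintegral => //.
- apply: integrable_norm.
  exact: (integrableB mD (integrable_FW i sab) (integrable_FW i s'ab)).
- exact: (integrableZl mD (C * `|s - s'|) (integrable_norm (Wi i))).
- by move=> x Dx; rewrite -mulrBl normrM ler_wpM2r// F_lipschitz.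
Qed.

Let c_continuous i : {within `[a, b], continuous (c i)}.
Proof.
apply/subspace_continuousP => x; rewrite /= in_itv /= => xab.
apply/cvgrPdist_le => e e0; rewrite near_withinE.
set L := C * (\int[mu]_(x in D) `|W i x|).
have L0 : 0 <= L by rewrite mulr_ge0// Rintegral_ge0.
(* The Lipschitz constant [L] may be zero, and [e] is going to be divided by it. *)
have L10 : 0 < L + 1 by rewrite ltr_wpDl.
near=> t; rewrite /= in_itv /= => tab.
rewrite (le_trans (c_lipschitz i xab tab))// -/L.
rewrite (@le_trans _ _ ((L + 1) * `|x - t|))// ?ler_wpM2r ?lerDl//.
rewrite -ler_pdivlMl// mulrC.
by near: t; exact: (@cvgr_dist_le R R^o R (nbhs x) _ id x cvg_id _ (divr_gt0 e0 L10)).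
Unshelve. all: by end_near. Qed.

Local Notation leb := (@lebesgue_measure R).

Let integrable_qc i : leb.-integrable `[a, b] (EFin \o (fun s => (q i).[s] * c i s)).
Proof.
apply: continuous_compact_integrable; first exact: segment_compact.
apply/subspace_continuousP => x xab.
apply: cvgM; first by apply: cvg_within_filter; exact: continuous_horner.
by have /subspace_continuousP := @c_continuous i; apply.
Qed.

Let itv_sub s : s \in `]a, b] -> a <= s <= b.
Proof. by rewrite in_itv /= => /andP[/ltW -> ->]. Qed.

Lemma integrable_L2_pairing : leb.-integrable `]a, b] (EFin \o phi).
Proof.
have : {in `]a, b]%classic, EFin \o (fun s => \sum_i (q i).[s] * c i s) =1 EFin \o phi}.
  by move=> s; rewrite inE /= => /itv_sub sab; rewrite /= phiE.
move=> E; apply: (@eq_integrable _ _ _ leb _ _ _ _ E) => //.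
apply: integrable_rsum => // i.
apply: integrableS (integrable_qc i) => //.
Qed.

(** [h] is any integrable majorant of the spatial L^1 norm of [G s]: no measurability in time of
    that norm has to be established, and the AM-GM bound can be inserted directly. *)
Lemma quadrature_L2_pairing_error (xi om : 'I_k.+1 -> R) (h : R -> R) :
  gauss_radau a b xi om ->
  leb.-integrable `]a, b] (EFin \o h) ->
  (forall s, a < s <= b -> \int[mu]_(x in D) `|G s x| <= h s) ->
  `|\int[leb]_(s in `]a, b]) phi s - quadrature xi om phi|
    <= C * (b - a) ^+ k.+1 * \int[leb]_(s in `]a, b]) h s.
Proof.
move=> [xiI xiab0 _ exact2k] hi Gh.
have xiab i : a <= xi i <= b.
  by have /andP[/ltW -> ->] := xiab0 i.
have [ell [sell ellxi]] := exists_lagrange_basis xiI.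
(* The pairing of the interpolant of [F] with [G]: the moments are linear in [F], so interpolating
   [F] in time amounts to interpolating each [c i]. *)
pose P : {poly R} := \sum_i q i * \sum_j c i (xi j) *: ell j.
have PE s : P.[s] = \sum_i (q i).[s] * \sum_j (ell j).[s] * c i (xi j).
  rewrite /P horner_sum; apply: eq_bigr => i _; rewrite hornerM horner_sum.
  by congr (_ * _); apply: eq_bigr => j _; rewrite hornerZ mulrC.
have sP : (size P <= (2 * k).+1)%N.
  rewrite (leq_trans (size_sum _ _ _))//; apply/bigmax_leqP => i _.
  rewrite (leq_trans (size_polyMleq _ _))//.
  have : (size (\sum_j c i (xi j) *: ell j)%R <= k.+1)%N.
    rewrite (leq_trans (size_sum _ _ _))//; apply/bigmax_leqP => j _.
    by rewrite (leq_trans (size_scale_leq _ _)).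
  move: (sq i); set u := size _; set v := size _ => uk vk.
  by rewrite -subn1 leq_subLR (leq_trans (leq_add uk vk))// mul2n -addnn addSn addnS add1n.
have Pxi j : P.[xi j] = phi (xi j).
  rewrite PE phiE//; apply: eq_bigr => i _; congr (_ * _).
  rewrite (bigD1 j)//= ellxi eqxx mul1r big1 ?addr0// => j' j'j.
  by rewrite ellxi (negbTE j'j) mul0r.
have -> : quadrature xi om phi = \int[leb]_(s in `]a, b]) P.[s].
  by rewrite -exact2k//; apply: eq_bigr => j _; rewrite Pxi.
have Pi : leb.-integrable `]a, b] (EFin \o horner P).
  have : leb.-integrable `[a, b] (EFin \o horner P).
    apply: continuous_compact_integrable; first exact: segment_compact.
    by apply: continuous_subspaceT; exact: continuous_horner.
  by apply: integrableS => //.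
have phii := integrable_L2_pairing.
have phiPi : leb.-integrable `]a, b] (EFin \o (fun s => phi s - P.[s])).
  exact: (integrableB _ phii Pi).
rewrite -RintegralB// (le_trans (le_normr_Rintegral _ phiPi))//.
rewrite -RintegralZl//; apply: le_Rintegral => //.
- exact: integrable_norm.
- exact: (integrableZl _ _ hi).
move=> s /= sab'; have sab := itv_sub sab'.
(* The interpolation error at time [s]; its pairing with [G s] is [phi s - P.[s]], and it is
   estimated at each point of [D] separately. *)
pose F' x := F s x - \sum_j (ell j).[s] * F (xi j) x.
have F'W i x : F' x * W i x =
    F s x * W i x - \sum_j (ell j).[s] * (F (xi j) x * W i x).
  by rewrite /F' mulrBl mulr_suml; congr (_ - _); apply: eq_bigr => j _; rewrite mulrA.
have sumi i : mu.-integrable D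
    (EFin \o (fun x => \sum_j (ell j).[s] * (F (xi j) x * W i x))).
  by apply: integrable_rsum => // j; exact: (integrableZl mD _ (integrable_FW i (xiab j))).
have F'Wi i : mu.-integrable D (EFin \o (fun x => F' x * W i x)).
  under eq_fun do rewrite /= F'W.
  exact: (integrableB mD (integrable_FW i sab) (sumi i)).
have F'G x : F' x * G s x = \sum_i (q i).[s] * (F' x * W i x).
  by rewrite mulr_sumr; apply: eq_bigr => i _; rewrite mulrCA.
have F'Gi : mu.-integrable D (EFin \o (fun x => F' x * G s x)).
  under eq_fun do rewrite /= F'G.
  by apply: integrable_rsum => // i; exact: (integrableZl mD _ (F'Wi i)).
have -> : phi s - P.[s] = \int[mu]_(x in D) (F' x * G s x).
  under eq_Rintegral do rewrite F'G.
  rewrite Rintegral_sum_scale// PE phiE// -sumrB; apply: eq_bigr => i _.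
  rewrite -mulrBr; congr (_ * _); under eq_Rintegral do rewrite F'W.
  rewrite RintegralB//; last exact: integrable_FW.
  rewrite Rintegral_sum_scale// => j; exact: integrable_FW.
rewrite (le_trans (le_normr_Rintegral _ F'Gi))//.
apply: (@le_trans _ _ (C * (b - a) ^+ k.+1 * \int[mu]_(x in D) `|G s x|)); last first.
  by rewrite ler_wpM2l ?Gh// mulr_ge0// exprn_ge0// subr_ge0 ltW.
rewrite -RintegralZl//; last exact: integrable_norm.
apply: le_Rintegral => //.
- exact: integrable_norm.
- exact: (integrableZl mD _ (integrable_norm (integrable_G s))).
move=> x Dx; rewrite normrM ler_wpM2r//.
apply: (@interpolation_error _ a b C k xi ell (F ^~ x)) => //.
exact: (derivs_bounded_deriv_bounded (FC Dx)).
Qed.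

End time_step_quadrature.

(** * Almost everywhere bounds in space and time *)

Section euclidean_measure.
Context {R : realType} (n : nat).
Local Notation T := 'rV[measurableTypeR R]_n.

Lemma ball_rVE (x y : 'rV[R]_n) (e : R) : 0 < e ->
  (forall i, `|x 0 i - y 0 i| < e) -> ball x e y.
Proof.
move=> e0 xy; rewrite -ball_normE /ball_ /= /Num.Def.normr /= mx_normrE.
by apply/bigmax_ltP; split => // -[i j] _; rewrite ord1 !mxE /=.
Qed.

Lemma normr_rV_coord (x : 'rV[R]_n) i : `|x 0 i| <= `|x|.
Proof.
rewrite [leRHS]/Num.Def.normr /= mx_normrE.
exact: (@le_bigmax _ _ _ _ (fun ij : 'I_1 * 'I_n => `|x ij.1 ij.2|) (0, i)).
Qed.

Lemma measurable_rV_box (I : 'I_n -> interval R) :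
  measurable [set x : T | forall i, x 0 i \in I i].
Proof.
rewrite (_ : [set _ | _] =
    \bigcap_(i in [set: 'I_n]) ((fun x : T => x 0 i) @^-1` [set` I i])).
  apply: fin_bigcap_measurable => // i _.
  by rewrite -[X in measurable X]setTI; exact: measurable_coord_rV.
by apply/seteqP; split=> x /= h i; [move=> _; exact: h|exact: (h i Logic.I)].
Qed.

(** The sigma-algebra is generated by the coordinates and not by the open sets, so [U] is written as
    a countable union of boxes with rational centre and rational half-width. *)
Lemma open_measurable_rV (U : set 'rV[R]_n) : open U -> @measurable _ T U.
Proof.
move=> oU.
pose B (p : 'rV[rat]_n * rat) : set T :=
  [set x | forall i, x 0 i \in `]ratr (p.1 0 i) - ratr p.2, ratr (p.1 0 i) + ratr p.2[ ].
rewrite (_ : U = \bigcup_p (if `[< B p `<=` U >] then B p else set0)); last first.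
  apply/seteqP; split=> [x Ux|x [p _]]; last by case: asboolP => // + Bx; exact.
  have /nbhs_ballP[e /= e0 xeU] : nbhs x U by exact: open_nbhs_nbhs.
  have [r] : exists r, ratr r \in `](0 : R), (e / 2)[.
    by apply: rat_in_itvoo; rewrite divr_gt0.
  rewrite in_itv /= => /andP[r0 re].
  have /choice[c cE] : forall i, exists c, `|x 0 i - ratr c| < ratr r.
    move=> i; have [c] : exists c, ratr c \in `](x 0 i - ratr r), (x 0 i + ratr r)[.
      by apply: rat_in_itvoo; lra.
    by rewrite in_itv /= => h; exists c; rewrite ltr_distlC.
  exists (\row_i c i, r) => //; case: asboolP => [_ i|].
    by rewrite in_itv /= mxE -ltr_distl.
  apply: contra_notP => _ y By; apply: xeU; apply: ball_rVE => // i.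
  have := By i; rewrite in_itv /= mxE -ltr_distl => h.
  by move: h (cE i); rewrite !ltr_norml => /andP[? ?] /andP[? ?]; apply/andP; split; lra.
apply: countable_bigcupT_measurable => [|p]; first exact: countableP.
by case: ifP => // _; exact: measurable_rV_box.
Qed.

Lemma bounded_measure_lty (U : set 'rV[R]_n) : open U -> bounded_set U ->
  (lebesgue_rV R n U < +oo)%E.
Proof.
move=> oU [M [_ /(_ (Num.max M 0 + 1))]].
set r := Num.max M 0 + 1; have r0 : 0 < r by rewrite ltr_wpDl// le_max lexx orbT.
have Mr : M < r by rewrite ltr_pwDr// le_max lexx.
move=> /(_ Mr) Ur.
pose B : set T := [set x : T | forall i, x 0 i \in `[- r, r]].
have UB : U `<=` B.
  by move=> x /Ur xr i; rewrite in_itv /= -ler_norml (le_trans (normr_rV_coord _ _)).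
apply: (@le_lt_trans _ _ (lebesgue_rV R n B)).
  apply: le_measure => //; rewrite inE; first exact: open_measurable_rV.
  exact: measurable_rV_box.
have -> : B = [set x : T | forall i,
    (- const_mx r : 'rV[R]_n) 0 i <= x 0 i <= (const_mx r : 'rV[R]_n) 0 i].
  by apply/seteqP; split => x /= h i; have := h i; rewrite in_itv /= !mxE.
rewrite lebesgue_rV_box ?ltry// => i; rewrite !mxE; lra.
Qed.

End euclidean_measure.

(* The exceptional null set in X may depend on s: a countable dense set of good
   times has a common null set, and closedness extends the property to all s. *)
Lemma ae_forall_itv d (X : measurableType d) (R : realType)
    (mu : {measure set X -> \bar R}) (P : R -> X -> Prop) (a b : R) :
  a < b -> (forall x, closed [set s | P s x]) ->
  {ae @lebesgue_measure R, forall s, a < s < b -> {ae mu, forall x, P s x}} ->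
  {ae mu, forall x, forall s, a <= s <= b -> P s x}.
Proof.
move=> ab cP [N [mN N0 goodN]].
pose J (r : rat * rat) s := ratr r.1 < s < ratr r.2 /\ {ae mu, forall x, P s x}.
(* One good time in each rational interval that contains any. The default [0] is harmless because
   [Q] only speaks of intervals with a good time. *)
have /choice[sigma sigmaP] : forall r, exists s, (exists s, J r s) -> J r s.
  move=> r; have [[s Js]|nJ] := pselect (exists s, J r s); first by exists s.
  by exists 0.
pose Q i x := if unpickle i is Some r then (exists s, J r s) -> P (sigma r) x else True.
have aeQ : forall i, {ae mu, forall x, Q i x}.
  move=> i; rewrite /Q; case: (unpickle i) => [r|]; last exact: aeW.
  have [eJ|nJ] := pselect (exists s, J r s); last by apply: aeW.
  by have [_] := sigmaP _ eJ; apply: filterS => x Px _.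
apply: filterS (ae_foralln aeQ) => x Qx s /andP[sa sb].
have : closure [set s | P s x] s; last first.
  by have /closure_id <- := cP x.
move=> V /nbhs_ballP[e /= e0 eV].
(* A rational interval is sought close to [s] and inside the open step; this also works when [s] is
   one of the endpoints [a], [b]. *)
have lu : Num.max a (s - e) < Num.min b (s + e).
  by rewrite lt_min !gt_max; apply/andP; split; apply/andP; split; lra.
have [r1] := rat_in_itvoo lu; rewrite in_itv /= gt_max lt_min.
move=> /andP[/andP[ar1 sr1] /andP[r1b r1s]].
have lu2 : ratr r1 < Num.min b (s + e) by rewrite lt_min r1b.
have [r2] := rat_in_itvoo lu2; rewrite in_itv /= lt_min.
move=> /andP[r12 /andP[r2b r2s]].
have [eJ|nJ] := pselect (exists s, J (r1, r2) s).
  have [/= /andP[l1 l2] _] := sigmaP _ eJ.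
  exists (sigma (r1, r2)); split.
    by have := Qx (pickle (r1, r2)); rewrite /Q pickleK; exact.
  by apply: eV; rewrite -ball_normE /ball_ /= ltr_distlC; lra.
(* Without a good time, a nonempty open interval would be contained in the null set [N]. *)
have : (@lebesgue_measure R `](ratr r1 : R), ratr r2[ <= lebesgue_measure N)%E.
  apply: le_measure; rewrite ?inE// => u /=; rewrite in_itv /= => /andP[u1 u2].
  apply: goodN => /= H; apply: nJ; exists u; split; first by rewrite u1.
  by apply: H; lra.
rewrite N0 lebesgue_measure_itv /= lte_fin r12 -EFinB lee_fin; lra.
Qed.

(** The interval is open because a derivative depends on a neighbourhood: at an end of a time step
    the discrete functions may jump, and their pointwise derivative need not be that of the
    polynomial. *)
Lemma derive1n_mx_horner (R : realType) (m n : nat) (u : R -> 'M[R]_(m, n))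
    (p : 'I_m -> 'I_n -> {poly R}) (a b : R) :
  (forall s, a < s < b -> u s = \matrix_(i, j) (p i j).[s]) ->
  forall l s, a < s < b -> derive1n l u s = \matrix_(i, j) (p i j)^`(l).[s].
Proof.
move=> up; elim=> [|l IH] s sab; first exact: up.
rewrite derive1nS derive1E.
rewrite (near_eq_derive (g := fun s => \matrix_(i, j) (p i j)^`(l).[s])); last first.
  have : \forall s' \near s, s' \in `]a, b[ by apply: near_in_itvoo; rewrite in_itv.
  by apply: filterS => s'; rewrite in_itv /= => /IH.
have dp i j : is_derive s (1 : R)
    (fun s => (\matrix_(i, j) (p i j)^`(l).[s] : 'M[R]_(m, n)) i j)
    (p i j)^`(l.+1).[s].
  rewrite derivnS (_ : (fun _ => _) = horner (p i j)^`(l)); last first.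
    by apply/funext => s'; rewrite mxE.
  exact: is_derive_poly.
rewrite derive_mx; last by apply/derivable_mxP => i j; exact: ex_derive.
by apply/matrixP => i j; rewrite !mxE derive_val.
Qed.

(** * Matrix-valued pairings and the stress *)

Section null_sets.
Context d (X : measurableType d) (R : realType).
Variables (mu : {measure set X -> \bar R}) (D N : set X).
Hypotheses (mD : measurable D) (mN : measurable N) (N0 : mu N = 0%E).

(** Allows the pairing to be studied off [N], where the bounds hold at every point and yield
    integrability. *)
Lemma Rintegral_setD_null (f : X -> R) : measurable_fun D f ->
  mu.-integrable (D `\` N) (EFin \o f) ->
  \int[mu]_(x in D) f x = \int[mu]_(x in D `\` N) f x.
Proof.
move=> mf fi; congr fine; apply: negligible_integral => //.
by apply/(negligible_integrable mN) => //; exact/measurable_EFinP.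
Qed.

End null_sets.

Section matrix_pairing.
Context dX (X : measurableType dX) (R : realType).
Variable mu : {measure set X -> \bar R}.
Variables Omega N : set X.
Hypotheses (mOmega : measurable Omega) (mN : measurable N) (N0 : mu N = 0%E).
Variables (a b C : R) (d k m : nat).
Hypotheses (ab : a < b) (C0 : 0 <= C).
Variables (F : R -> X -> 'M[R]_d) (q : 'I_m -> {poly R}) (W : 'I_m -> X -> 'M[R]_d).
Hypothesis FC : forall x i j, (Omega `\` N) x ->
  derivs_bounded a b C k.+1 (fun s => F s x i j).
Hypothesis mF : forall s i j, measurable_fun Omega (fun x => F s x i j).
Hypothesis Wi : forall l i j, mu.-integrable Omega (fun x => (W l x i j)%:E).
Hypothesis sq : forall l, (size (q l) <= k.+1)%N.

Let D := Omega `\` N.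
Let mD : measurable D. Proof. exact: measurableD. Qed.
Let G s x : 'M[R]_d := \sum_l (q l).[s] *: W l x.
Let phi i j s := \int[mu]_(x in D) (F s x i j * (\sum_l (q l).[s] * W l x i j)).

Let GE s x i j : G s x i j = \sum_l (q l).[s] * W l x i j.
Proof. by rewrite summxE; apply: eq_bigr => l _; rewrite mxE. Qed.

Let WiD l i j : mu.-integrable D (EFin \o (fun x => W l x i j)).
Proof. by apply: integrableS (Wi l i j) => //; exact: subDsetl. Qed.

Let mFD s i j : measurable_fun D (fun x => F s x i j).
Proof. by apply: measurable_funS (mF s i j) => //; exact: subDsetl. Qed.

Let integrable_GD s i j : mu.-integrable D (EFin \o (fun x => \sum_l (q l).[s] * W l x i j)).
Proof.
apply: integrable_rsum => // l; exact: (integrableZl mD (q l).[s] (WiD l i j)).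
Qed.

Let integrable_FG s i j : a <= s <= b ->
  mu.-integrable D (EFin \o (fun x => F s x i j * (\sum_l (q l).[s] * W l x i j))).
Proof.
move=> sab; have := integrableMr mD (mFD s i j) _ (integrable_GD s i j); apply.
exists C; split; first exact: num_real.
move=> y Cy x Dx /=.
by rewrite (le_trans _ (ltW Cy))// (derivs_bounded0 (FC i j Dx)).
Qed.

Let measurable_W l i j : measurable_fun Omega (fun x => W l x i j).
Proof. by apply/measurable_EFinP; exact: measurable_int (Wi l i j). Qed.

Let pairing_sum s : a <= s <= b ->
  \int[mu]_(x in Omega) mxinner (F s x) (G s x) =
  \sum_(ij : 'I_d * 'I_d) phi ij.1 ij.2 s.
Proof.
move=> sab.
have E x : mxinner (F s x) (G s x) = \sum_(ij : 'I_d * 'I_d)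
    F s x ij.1 ij.2 * (\sum_l (q l).[s] * W l x ij.1 ij.2).
  rewrite /mxinner pair_big /=; apply: eq_bigr => -[i j] _ /=.
  by rewrite GE.
under eq_Rintegral do rewrite E.
rewrite (Rintegral_setD_null mOmega mN N0).
- by rewrite Rintegral_sum// => -[i j]; exact: integrable_FG.
- apply: measurable_sum => -[i j] /=; apply: measurable_funM => //.
  apply: measurable_sum => l; apply: measurable_funM => //; exact: measurable_cst.
- by apply: integrable_rsum => // -[i j]; exact: integrable_FG.
Qed.

Local Notation leb := (@lebesgue_measure R).

(** The scalar estimate is applied to each entry, which costs the factor [d * d]. Agreement of [f]
    with the pairing on []a, b]] is enough, since this interval contains all nodes. *)
Lemma quadrature_matrix_pairing_error (xi om : 'I_k.+1 -> R) (f h : R -> R) :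
  gauss_radau a b xi om ->
  leb.-integrable `]a, b] (EFin \o h) ->
  (forall s i j, a < s <= b -> \int[mu]_(x in D) `|G s x i j| <= h s) ->
  (forall s, a < s <= b -> f s = \int[mu]_(x in Omega) mxinner (F s x) (G s x)) ->
  `|\int[leb]_(s in `]a, b]) f s - quadrature xi om f|
    <= (d * d)%:R * (C * (b - a) ^+ k.+1 * \int[leb]_(s in `]a, b]) h s).
Proof.
move=> GR hi Gh fE.
have phii i j : leb.-integrable `]a, b] (EFin \o phi i j).
  apply: (@integrable_L2_pairing _ X R mu D mD a b C C0 k m
    (fun s x => F s x i j) q (fun l x => W l x i j)) => //.
  by move=> x; exact: FC.
have err i j : `|\int[leb]_(s in `]a, b]) phi i j s - quadrature xi om (phi i j)|
    <= C * (b - a) ^+ k.+1 * \int[leb]_(s in `]a, b]) h s.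
  apply: (@quadrature_L2_pairing_error _ X R mu D mD a b C ab C0 k m
    (fun s x => F s x i j) q (fun l x => W l x i j)) => //.
    by move=> x; exact: FC.
  by move=> s /(Gh s i j); under eq_Rintegral do rewrite GE.
have fE' s : a < s <= b -> f s = \sum_(ij : 'I_d * 'I_d) phi ij.1 ij.2 s.
  by move=> sab; rewrite fE// pairing_sum//; case/andP: sab => /ltW -> ->.
have -> : \int[leb]_(s in `]a, b]) f s =
    \sum_(ij : 'I_d * 'I_d) \int[leb]_(s in `]a, b]) phi ij.1 ij.2 s.
  rewrite -Rintegral_sum//.
  by apply: eq_Rintegral => s; rewrite inE /= in_itv /= => /fE'.
have -> : quadrature xi om f = \sum_(ij : 'I_d * 'I_d) quadrature xi om (phi ij.1 ij.2).
  rewrite /quadrature exchange_big /=; apply: eq_bigr => l _.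
  by have [_ /(_ l) xil _ _] := GR; rewrite fE'// mulr_sumr.
rewrite -sumrB (le_trans (ler_norm_sum _ _ _))//.
rewrite (le_trans (ler_sum _ (fun ij _ => err ij.1 ij.2)))//.
by rewrite sumr_const card_prod card_ord mulr_natl.
Qed.

End matrix_pairing.

Section frobenius.
Context {R : realType} (m n : nat).
Implicit Types M : 'M[R]_(m, n).

Lemma sqr_frob M : frob M ^+ 2 = mxinner M M.
Proof.
rewrite sqr_sqrtr//; apply: sumr_ge0 => i _; apply: sumr_ge0 => j _.
exact: sqr_ge0.
Qed.

Lemma sqr_entry_frob M i j : M i j ^+ 2 <= frob M ^+ 2.
Proof.
rewrite sqr_frob /mxinner (bigD1 i)//= (bigD1 j)//= -expr2 -addrA lerDl.
by rewrite addr_ge0// !sumr_ge0// => *; rewrite ?sumr_ge0// => *; exact: sqr_ge0.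
Qed.

Lemma normr_entry_frob M i j : `|M i j| <= frob M.
Proof.
by rewrite -ler_sqr ?nnegrE ?sqrtr_ge0// real_normK ?num_real// sqr_entry_frob.
Qed.

End frobenius.

Lemma derivs_bounded_stress (R : realType) (d k m : nat)
    (A p nuinf nu delta : R) : p < 2 -> 0 < delta -> 0 <= A ->
  exists2 C, 0 <= C & forall a b (e : 'I_d -> 'I_d -> {poly R}),
    (forall i j, (size (e i j) <= k.+1)%N) ->
    (forall i j l s, (l <= k)%N -> a <= s <= b -> `|(e i j)^`(l).[s]| <= A) ->
    forall i j, derivs_bounded a b C m
      (fun s => stress p nuinf nu delta (\matrix_(i, j) (e i j).[s]) i j).
Proof.
move=> p2 delta0 A0.
have r0 : (p - 2) / 2 <= 0 by lra.
have delta20 : 0 < delta ^+ 2 by rewrite exprn_gt0.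
(* Bounds delta^2 + |Dv|^2 and its derivatives: [2 ^+ m * (A * A)] comes from the Leibniz rule for
   one squared entry, and there are [d * d] entries. *)
pose Cg := delta ^+ 2 + d%:R * (d%:R * (2 ^+ m * (A * A))).
have [D D0 DP] := derivs_bounded_powR Cg m delta20 r0.
exists (2 ^+ m * ((`|nuinf| + `|nu| * D) * A)) => [|a b e se eA i j].
  by rewrite !(mulr_ge0, addr_ge0)// exprn_ge0.
have eb i' j' : derivs_bounded a b A m (horner (e i' j')).
  by apply: (@derivs_bounded_horner _ a b A k) => // l s; exact: eA.
pose g s := delta ^+ 2 + \sum_i \sum_j (e i j).[s] * (e i j).[s].
have -> : (fun s => stress p nuinf nu delta (\matrix_(i, j) (e i j).[s]) i j) =
    (cst nuinf + (fun s => nu * g s `^ ((p - 2) / 2))) * horner (e i j).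
  apply/funext => s; rewrite /stress mxE mxE sqr_frob.
  rewrite (_ : mxinner _ _ = \sum_i \sum_j (e i j).[s] * (e i j).[s])//.
  by apply: eq_bigr => i' _; apply: eq_bigr => j' _; rewrite !mxE.
apply: derivs_boundedM => //; apply: derivs_boundedD.
  exact: derivs_bounded_cst.
apply: derivs_boundedZ; apply: DP => [s|].
  by rewrite lerDl; apply: sumr_ge0 => i' _; apply: sumr_ge0 => j' _; exact: sqr_ge0.
apply: (@derivs_boundedD _ _ _ _ _ _ (cst (delta ^+ 2))).
  by apply: derivs_bounded_cst; rewrite ger0_norm// ltW.
do 2 apply: derivs_bounded_sum => ?.
exact: derivs_boundedM.
Qed.

(** * Sobolev pairs on one time step *)

Section square_integrability.
Context d (X : measurableType d) (R : realType).
Variables (mu : {measure set X -> \bar R}) (D : set X).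
Hypothesis mD : measurable D.

Lemma integrable_sqr (f : X -> R) : measurable_fun D f ->
  (\int[mu]_(x in D) (f x ^+ 2)%:E < +oo)%E ->
  mu.-integrable D (EFin \o (fun x => f x ^+ 2)).
Proof.
move=> mf fi; apply/integrableP; split.
  by apply/measurable_EFinP; exact: measurable_funX.
rewrite (eq_integral (fun x => (f x ^+ 2)%:E))// => x _.
by rewrite /= ger0_norm// sqr_ge0.
Qed.

Lemma integrable_mul (f g : X -> R) :
  measurable_fun D f -> measurable_fun D g ->
  mu.-integrable D (EFin \o (fun x => f x ^+ 2)) ->
  mu.-integrable D (EFin \o (fun x => g x ^+ 2)) ->
  mu.-integrable D (EFin \o (fun x => f x * g x)).
Proof.
move=> mf mg fi gi.
apply: (le_integrable mD _ _ (integrableD mD fi gi)).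
  by apply/measurable_EFinP; exact: measurable_funM.
move=> x Dx; rewrite /= lee_fin [leRHS]ger0_norm; last by rewrite addr_ge0// sqr_ge0.
by rewrite ler_norml; apply/andP; split; nra.
Qed.

(** The left side is taken over a subset because the pairing error is estimated off a null set,
    while the norm of [z] is taken over the whole domain. *)
Lemma Rintegral_normr_AMGM (E : set X) (f n : X -> R) (lambda : R) :
  0 < lambda -> (mu D < +oo)%E -> measurable E -> E `<=` D ->
  mu.-integrable D (EFin \o f) -> mu.-integrable D (EFin \o n) ->
  (forall x, D x -> f x ^+ 2 <= n x) ->
  \int[mu]_(x in E) `|f x| <=
    (lambda * fine (mu D) + (\int[mu]_(x in D) n x) / lambda) / 2.
Proof.
move=> l0 Doo mE ED fi ni fn.
have ci : mu.-integrable D (EFin \o cst (lambda / 2)).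
  apply: measurable_bounded_integrable => //.
  by exists `|lambda / 2|; split; [exact: num_real|move=> y /ltW + x _].
have nli := integrableZl mD (2 * lambda)^-1 ni.
have fE : mu.-integrable D (EFin \o (fun x => `|f x|)) by exact: integrable_norm.
have -> : (lambda * fine (mu D) + (\int[mu]_(x in D) n x) / lambda) / 2 =
   \int[mu]_(x in D) (cst (lambda / 2) x + (2 * lambda)^-1 * n x).
  rewrite RintegralD// Rintegral_cst// RintegralZl//.
  by field; rewrite gt_eqF.
apply: (@le_trans _ _ (\int[mu]_(x in D) `|f x|)).
  have fEE : mu.-integrable E (EFin \o (fun x => `|f x|)) by exact: integrableS fE.
  apply: fine_le; [exact: integrable_fin_num|exact: integrable_fin_num|].
  apply: ge0_subset_integral => //.
  exact: measurable_int fE.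
apply: le_Rintegral => //; first exact: (integrableD mD ci nli).
move=> x Dx /=; have := fn _ Dx; rewrite -[f x ^+ 2]real_normK ?num_real// => fx.
have -> : lambda / 2 + (2 * lambda)^-1 * n x = (lambda ^+ 2 + n x) / (2 * lambda).
  by field; rewrite gt_eqF.
by rewrite ler_pdivlMr ?mulr_gt0//; have := sqr_ge0 (lambda - `|f x|); nra.
Qed.

(** Expanding the square gives the quadratic form of the Gram matrix of the [u l], evaluated at the
    values of the [q l]. It follows that the squared H^1 norm is polynomial on a time step, hence
    integrable in time. *)
Lemma Rintegral_sqr_horner (m : nat) (q : 'I_m -> {poly R}) (u : 'I_m -> X -> R) :
  (forall l, measurable_fun D (u l)) ->
  (forall l, mu.-integrable D (EFin \o (fun x => u l x ^+ 2))) ->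
  exists P : {poly R}, forall s,
    mu.-integrable D (EFin \o (fun x => (\sum_l (q l).[s] * u l x) ^+ 2)) /\
    \int[mu]_(x in D) (\sum_l (q l).[s] * u l x) ^+ 2 = P.[s].
Proof.
move=> mu' ui.
exists (\sum_(ij : 'I_m * 'I_m)
  (\int[mu]_(x in D) (u ij.1 x * u ij.2 x)) *: (q ij.1 * q ij.2)) => s.
have E x : (\sum_l (q l).[s] * u l x) ^+ 2 =
    \sum_(ij : 'I_m * 'I_m) ((q ij.1).[s] * (q ij.2).[s]) * (u ij.1 x * u ij.2 x).
  rewrite expr2 mulr_suml.
  rewrite -(pair_big xpredT xpredT (fun i j => ((q i).[s] * (q j).[s]) * (u i x * u j x)))/=.
  apply: eq_bigr => i _; rewrite mulr_sumr; apply: eq_bigr => j _.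
  by rewrite mulrACA.
have uij i j : mu.-integrable D (EFin \o (fun x => u i x * u j x)).
  by apply: integrable_mul.
have quij (ij : 'I_m * 'I_m) : mu.-integrable D
    (EFin \o (fun x => ((q ij.1).[s] * (q ij.2).[s]) * (u ij.1 x * u ij.2 x))).
  exact: (integrableZl mD _ (uij _ _)).
split.
  by under eq_fun do rewrite /= E; exact: integrable_rsum.
under eq_Rintegral do rewrite E.
rewrite Rintegral_sum// horner_sum; apply: eq_bigr => -[i j] _ /=.
by rewrite RintegralZl// hornerZ hornerM mulrC.
Qed.

End square_integrability.

Section sobolev_sums.
Context {R : realType} {d : nat}.
Local Notation E := 'rV[R]_d.

Lemma sobolev_sum1E m (c : 'I_m -> R) (w : 'I_m -> sobolev_pair R d) x i :
  (\sum_l c l *: w l).1 x 0 i = \sum_l c l * (w l).1 x 0 i.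
Proof.
rewrite (big_morph (fun p : sobolev_pair R d => p.1 x 0 i) (id1 := 0) (op1 := +%R)).
- by apply: eq_bigr => l _; rewrite mxE.
- by move=> p q; rewrite mxE.
- by rewrite mxE.
Qed.

Lemma sobolev_sum2E m (c : 'I_m -> R) (w : 'I_m -> sobolev_pair R d) x :
  (\sum_l c l *: w l).2 x = \sum_l c l *: (w l).2 x.
Proof.
exact: (big_morph (fun p : sobolev_pair R d => p.2 x) (id1 := 0) (op1 := +%R)).
Qed.

End sobolev_sums.

Section one_time_step.
Context {R : realType} {d : nat}.
Local Notation E := 'rV[R]_d.
Local Notation mu := (lebesgue_rV R d).
Local Notation leb := (@lebesgue_measure R).
Variables (Omega : set E) (a b : R) (k : nat).
Hypotheses (oOmega : open Omega) (Omegaoo : (mu Omega < +oo)%E) (ab : a < b).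

Let mOmega : @measurable _ 'rV[measurableTypeR R]_d Omega.
Proof. exact: open_measurable_rV. Qed.

Section separated_variables.
Variables (m : nat) (q : 'I_m -> {poly R}) (w : 'I_m -> sobolev_pair R d).
Variable v : R -> sobolev_pair R d.
Hypothesis sq : forall l, (size (q l) <= k.+1)%N.
Hypothesis wH1 : forall l, H1 Omega (w l).
Hypothesis vE : forall s, a < s <= b -> v s = \sum_l (q l).[s] *: w l.

Definition value_poly (x : E) i : {poly R} := \sum_l (w l).1 x 0 i *: q l.
Definition grad_poly (x : E) i j : {poly R} := \sum_l (w l).2 x i j *: q l.

Lemma size_value_poly x i : (size (value_poly x i) <= k.+1)%N.
Proof.
rewrite (leq_trans (size_sum _ _ _))//; apply/bigmax_leqP => l _.
exact: leq_trans (size_scale_leq _ _) _.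
Qed.

Lemma size_grad_poly x i j : (size (grad_poly x i j) <= k.+1)%N.
Proof.
rewrite (leq_trans (size_sum _ _ _))//; apply/bigmax_leqP => l _.
exact: leq_trans (size_scale_leq _ _) _.
Qed.

Lemma value_polyE s x : a < s <= b -> (v s).1 x = \row_i (value_poly x i).[s].
Proof.
move=> sab; apply/rowP => i; rewrite vE// sobolev_sum1E mxE horner_sum.
by apply: eq_bigr => l _; rewrite hornerZ mulrC.
Qed.

Lemma grad_polyE s x : a < s <= b ->
  (v s).2 x = \matrix_(i, j) (grad_poly x i j).[s].
Proof.
move=> sab; apply/matrixP => i j; rewrite vE// sobolev_sum2E mxE summxE horner_sum.
by apply: eq_bigr => l _; rewrite hornerZ mxE mulrC.
Qed.

(** The norms give bounds for almost every time and then almost every point, with a null set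
    depending on the time. Continuity of polynomials exchanges the two: one null set in space serves
    all times of the closed step, the nodes included. *)
Lemma ae_derivn_bounded (A : R) :
  (forall l, (l <= k)%N -> (LinfW1infnorm Omega `]a, b] (dtime l v) <= A%:E)%E) ->
  {ae mu, forall x, Omega x -> forall l s, (l <= k)%N -> a <= s <= b ->
    (forall i, `|(value_poly x i)^`(l).[s]| <= A) /\
    (forall i j, `|(grad_poly x i j)^`(l).[s]| <= A)}.
Proof.
move=> vA.
(* All polynomials to be bounded at [x] are gathered, so that the exchange is made once. Off [Omega]
   the set is empty and the bound is void. *)
pose S x : set {poly R} := [set p | Omega x /\ exists2 l, (l <= k)%N &
  (exists i, p = (value_poly x i)^`(l)) \/
  (exists i j, p = (grad_poly x i j)^`(l))].
have : {ae mu, forall x, forall s, a <= s <= b -> forall p, S x p -> `|p.[s]| <= A}.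
  apply: (@ae_forall_itv _ _ _ mu
    (fun s x => forall p, S x p -> `|p.[s]| <= A)) => // [x|].
    rewrite (_ : [set s | _] =
        \bigcap_(p in S x) ((fun s => `|p.[s]|) @^-1` [set y | y <= A])); last first.
      by apply/seteqP; split=> s /= h p; exact: h.
    apply: closed_bigI => p _; apply: preimage_closed; last exact: closed_le.
    move=> s _; apply: (@continuous_comp _ _ _ (horner p) Num.norm).
      exact: continuous_horner.
    exact: norm_continuous.
  have : {ae leb, forall s, forall l, (l <= k)%N -> a < s < b ->
      (W1infnorm Omega (dtime l v s) <= A%:E)%E}.
    apply: ae_foralln => l; have [lk|kl] := leqP l k; last first.
      by apply: aeW => s; rewrite ?leqNgt ?kl.
    have /ess_supP := vA l lk; apply: filterS => s + _ /andP[as_ sb].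
    rewrite patchE mem_set//= in_itv /= as_; exact: ltW.
  apply: (@filterS _ (almost_everywhere leb)) => s H sab.
  have : {ae mu, forall x, forall l, (l <= k)%N -> Omega x ->
      frob ((dtime l v s).1 x) <= A /\ frob ((dtime l v s).2 x) <= A}.
    apply: ae_foralln => l; have [lk|kl] := leqP l k; last first.
      by apply: aeW => x; rewrite ?leqNgt ?kl.
    have := H l lk sab; rewrite ge_max => /andP[/ess_supP h1 /ess_supP h2].
    apply: filterS2 h1 h2 => x h1 h2 _ Ox.
    by move: h1 h2; rewrite !patchE mem_set// !lee_fin.
  apply: (@filterS _ (almost_everywhere mu)) => x Hx p [Ox [l lk]].
  have [h1 h2] := Hx l lk Ox.
  move=> [[i ->]|[i [j ->]]].
    apply: le_trans h1; apply: le_trans (normr_entry_frob _ 0 i).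
    rewrite /= (@derive1n_mx_horner _ _ _ _ (fun _ i => value_poly x i) a b)// ?mxE//.
    move=> s' /andP[as' s'b]; rewrite value_polyE ?as' ?ltW//.
  apply: le_trans h2; apply: le_trans (normr_entry_frob _ i j).
  rewrite /= (@derive1n_mx_horner _ _ _ _ (fun i j => grad_poly x i j) a b)// ?mxE//.
  move=> s' /andP[as' s'b]; rewrite grad_polyE ?as' ?ltW//.
apply: (@filterS _ (almost_everywhere mu)) => x Hx Ox l s lk sab.
split=> [i|i j]; apply: Hx => //; split => //.
  by exists l => //; left; exists i.
by exists l => //; right; exists i, j.
Qed.

Lemma measurable_value_poly s i :
  measurable_fun Omega (fun x : 'rV[measurableTypeR R]_d =>
    (value_poly x i).[s] : measurableTypeR R).
Proof.
rewrite (_ : (fun _ => _) = fun x => \sum_l (w l).1 x 0 i * (q l).[s]); last first.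
  by apply/funext => x; rewrite horner_sum; apply: eq_bigr => l _; rewrite hornerZ.
apply: measurable_sum => l; apply: measurable_funM; last exact: measurable_cst.
by have [/(_ i)[]] := wH1 l.
Qed.

Lemma measurable_grad_poly s i j :
  measurable_fun Omega (fun x : 'rV[measurableTypeR R]_d =>
    (grad_poly x i j).[s] : measurableTypeR R).
Proof.
rewrite (_ : (fun _ => _) = fun x => \sum_l (w l).2 x i j * (q l).[s]); last first.
  by apply/funext => x; rewrite horner_sum; apply: eq_bigr => l _; rewrite hornerZ.
apply: measurable_sum => l; apply: measurable_funM; last exact: measurable_cst.
by have [_ /(_ i j)[]] := wH1 l.
Qed.

Lemma sqr_H1norm_horner : exists P : {poly R}, forall s, a < s <= b ->
  mu.-integrable Omega
    (EFin \o (fun x => frob ((v s).1 x) ^+ 2 + frob ((v s).2 x) ^+ 2)) /\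
  H1norm Omega (v s) ^+ 2 = P.[s].
Proof.
have /choice[P1 P1E] : forall i, exists P : {poly R}, forall s,
    mu.-integrable Omega (EFin \o (fun x => (\sum_l (q l).[s] * (w l).1 x 0 i) ^+ 2)) /\
    \int[mu]_(x in Omega) (\sum_l (q l).[s] * (w l).1 x 0 i) ^+ 2 = P.[s].
  move=> i; apply: (Rintegral_sqr_horner mOmega) => l;
    have [/(_ i)[mw iw] _ _] := wH1 l.
    exact: mw.
  exact: (integrable_sqr mw iw).
have /choice[P2 P2E] : forall ij : 'I_d * 'I_d, exists P : {poly R}, forall s,
    mu.-integrable Omega
      (EFin \o (fun x => (\sum_l (q l).[s] * (w l).2 x ij.1 ij.2) ^+ 2)) /\
    \int[mu]_(x in Omega) (\sum_l (q l).[s] * (w l).2 x ij.1 ij.2) ^+ 2 = P.[s].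
  move=> [i j]; apply: (Rintegral_sqr_horner mOmega) => l;
    have [_ /(_ i j)[mw iw] _] := wH1 l.
    exact: mw.
  exact: (integrable_sqr mw iw).
exists (\sum_i P1 i + \sum_ij P2 ij) => s sab.
have E1 x : frob ((v s).1 x) ^+ 2 = \sum_i (\sum_l (q l).[s] * (w l).1 x 0 i) ^+ 2.
  rewrite sqr_frob /mxinner big_ord1; apply: eq_bigr => i _.
  by rewrite vE// sobolev_sum1E expr2.
have E2 x : frob ((v s).2 x) ^+ 2 =
    \sum_(ij : 'I_d * 'I_d) (\sum_l (q l).[s] * (w l).2 x ij.1 ij.2) ^+ 2.
  rewrite sqr_frob /mxinner pair_big /=; apply: eq_bigr => -[i j] _ /=.
  rewrite vE// sobolev_sum2E summxE expr2.
  by congr (_ * _); apply: eq_bigr => l _; rewrite mxE.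
have i1 : mu.-integrable Omega (EFin \o (fun x => frob ((v s).1 x) ^+ 2)).
  under eq_fun do rewrite /= E1.
  by apply: (integrable_rsum mOmega) => i; have [] := P1E i s.
have i2 : mu.-integrable Omega (EFin \o (fun x => frob ((v s).2 x) ^+ 2)).
  under eq_fun do rewrite /= E2.
  by apply: (integrable_rsum mOmega) => i; have [] := P2E i s.
split; first exact: (integrableD mOmega i1 i2).
rewrite sqr_sqrtr; last first.
  by apply: Rintegral_ge0 => x _; rewrite addr_ge0// sqr_ge0.
rewrite (RintegralD mOmega i1 i2) hornerD !horner_sum; congr (_ + _).
  under eq_Rintegral do rewrite E1.
  rewrite (Rintegral_sum mOmega); last by move=> i; have [] := P1E i s.
  by apply: eq_bigr => i _; have [] := P1E i s.
under eq_Rintegral do rewrite E2.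
rewrite (Rintegral_sum mOmega); last by move=> i; have [] := P2E i s.
by apply: eq_bigr => i _; have [] := P2E i s.
Qed.

End separated_variables.

End one_time_step.

(** * Quadrature errors of the convective and viscous terms on one step *)

Section consistency_error.
Context {R : realType} {d : nat}.
Local Notation E := 'rV[R]_d.
Local Notation mu := (lebesgue_rV R d).
Local Notation leb := (@lebesgue_measure R).
Variables (Omega : set E) (a b : R) (k : nat).
Hypotheses (oOmega : open Omega) (Omegaoo : (mu Omega < +oo)%E) (ab : a < b).
Variables (mv mz : nat) (qv : 'I_mv -> {poly R}) (wv : 'I_mv -> sobolev_pair R d).
Variables (qz : 'I_mz -> {poly R}) (wz : 'I_mz -> sobolev_pair R d).
Variables v z : R -> sobolev_pair R d.
Hypothesis sqv : forall l, (size (qv l) <= k.+1)%N.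
Hypothesis sqz : forall l, (size (qz l) <= k.+1)%N.
Hypothesis wvH1 : forall l, H1 Omega (wv l).
Hypothesis wzH1 : forall l, H1 Omega (wz l).
Hypothesis vE : forall s, a < s <= b -> v s = \sum_l (qv l).[s] *: wv l.
Hypothesis zE : forall s, a < s <= b -> z s = \sum_l (qz l).[s] *: wz l.
Variables (xi om : 'I_k.+1 -> R).
Hypothesis GR : gauss_radau a b xi om.
Variables (A lambda : R).
Hypotheses (A0 : 0 <= A) (lambda0 : 0 < lambda).
Hypothesis vA :
  forall l, (l <= k)%N -> (LinfW1infnorm Omega `]a, b] (dtime l v) <= A%:E)%E.

Let mOmega : @measurable _ 'rV[measurableTypeR R]_d Omega.
Proof. exact: open_measurable_rV. Qed.

(** Plays the part of the majorant [h]: it dominates the spatial L^1 norm of every entry of grad z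
    and of Dz at time [s], with lambda still free. *)
Definition AMGM_weight s : R :=
  (lambda * fine (mu Omega) + H1norm Omega (z s) ^+ 2 / lambda) / 2.

Lemma integrable_sqr_H1norm :
  leb.-integrable `]a, b] (EFin \o (fun s => H1norm Omega (z s) ^+ 2)).
Proof.
have [P PE] := sqr_H1norm_horner oOmega wzH1 zE.
have HP : {in `]a, b]%classic,
    EFin \o horner P =1 EFin \o (fun s => H1norm Omega (z s) ^+ 2)}.
  by move=> s; rewrite inE /= in_itv /= => /PE[_ ->].
apply: (@eq_integrable _ _ _ leb _ _ _ _ HP) => //.
have : leb.-integrable `[a, b] (EFin \o horner P).
  apply: continuous_compact_integrable; first exact: segment_compact.
  by apply: continuous_subspaceT; exact: continuous_horner.
apply: integrableS => // s.
by rewrite /= !in_itv /= => /andP[/ltW -> ->].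
Qed.

Lemma integrable_AMGM_weight : leb.-integrable `]a, b] (EFin \o AMGM_weight).
Proof.
have ci : leb.-integrable `]a, b] (EFin \o cst (lambda * fine (mu Omega) / 2)).
  apply: measurable_bounded_integrable => //.
    by rewrite /= lebesgue_measure_itv /= lte_fin ab -EFinB ltry.
  by exists `|lambda * fine (mu Omega) / 2|; split; [exact: num_real|move=> y /ltW + x _].
have mi : @measurable _ (measurableTypeR R) `]a, b] by [].
have := integrableD mi ci (integrableZl mi (2 * lambda)^-1 integrable_sqr_H1norm).
apply: eq_integrable => // s _.
by rewrite /= -EFinM -EFinD /AMGM_weight; congr (_%:E); field; rewrite gt_eqF.
Qed.

(** On a set of finite measure L^2 is contained in L^1: multiply by the constant 1. *)
Let wz_integrable l i j : mu.-integrable Omega (fun x => ((wz l).2 x i j)%:E).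
Proof.
have [_ /(_ i j)[mw iw] _] := wzH1 l.
have c1 : mu.-integrable Omega (EFin \o (fun x => (cst (1 : R) x) ^+ 2)).
  apply: measurable_bounded_integrable => //.
    exact: (measurable_cst ((1 : R) ^+ 2)).
  by exists 1; split; [exact: num_real|move=> y /ltW + x _; rewrite /= expr1n normr1].
have := integrable_mul mOmega mw (measurable_cst _) (integrable_sqr mw iw) c1.
by apply: eq_integrable => // x _ /=; rewrite mulr1.
Qed.

Let AMGM_weight_bound (D : set E) (g : E -> R) s : a < s <= b ->
  @measurable _ 'rV[measurableTypeR R]_d D -> D `<=` Omega ->
  mu.-integrable Omega (EFin \o g) ->
  (forall x, g x ^+ 2 <= frob ((z s).2 x) ^+ 2) ->
  \int[mu]_(x in D) `|g x| <= AMGM_weight s.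
Proof.
move=> sab mD DO gi gz.
have [P /(_ _ sab)[ni _]] := sqr_H1norm_horner oOmega wzH1 zE.
rewrite /AMGM_weight sqr_sqrtr; last first.
  by apply: Rintegral_ge0 => x _; rewrite addr_ge0// sqr_ge0.
apply: (Rintegral_normr_AMGM mOmega) => // x _.
by rewrite (le_trans (gz x))// lerDr sqr_ge0.
Qed.

Let null_complement (P : E -> Prop) : {ae mu, forall x, Omega x -> P x} ->
  exists N, [/\ @measurable _ 'rV[measurableTypeR R]_d N, mu N = 0%E &
    forall x, (Omega `\` N) x -> P x].
Proof.
move=> [N [mN N0 HN]]; exists N; split => // x [Ox Nx].
by apply: contrapT => nP; apply: Nx; apply: HN => /= /(_ Ox).
Qed.

(** An entry of v (x) v is a product of two polynomials in time bounded by [A] with their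
    derivatives, so the Leibniz rule at order [k + 1] gives [2 ^+ k.+1 * (A * A)]. *)
Lemma conv_quadrature_error :
  `|\int[leb]_(s in `]a, b]) phi_conv Omega v z s -
     quadrature xi om (phi_conv Omega v z)|
  <= (d * d)%:R * (2 ^+ k.+1 * (A * A) * (b - a) ^+ k.+1 *
       \int[leb]_(s in `]a, b]) AMGM_weight s).
Proof.
have [N [mN N0 NP]] := null_complement (ae_derivn_bounded ab vE vA).
apply: (@quadrature_matrix_pairing_error _ _ R mu Omega N mOmega mN N0 a b _ d k mz ab _
  (fun s x => outer (\row_i (value_poly qv wv x i).[s])
    (\row_i (value_poly qv wv x i).[s]))
  qz (fun l x => (wz l).2 x)) => //.
- by rewrite !mulr_ge0// exprn_ge0.
- move=> x i j /NP H.
  have Hi i' : derivs_bounded a b A k.+1 (horner (value_poly qv wv x i')).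
    apply: (@derivs_bounded_horner _ a b A k) => //; first exact: size_value_poly.
    by move=> l s lk sab; have [] := H l s lk sab.
  rewrite (_ : (fun _ => _) =
      horner (value_poly qv wv x i) * horner (value_poly qv wv x j)).
    exact: derivs_boundedM.
  by apply/funext => s; rewrite !mxE big_ord1 !mxE.
- move=> s i j.
  rewrite (_ : (fun _ => _) =
      (fun x => (value_poly qv wv x i).[s] * (value_poly qv wv x j).[s])).
    by apply: measurable_funM; exact: measurable_value_poly.
  by apply/funext => x; rewrite !mxE big_ord1 !mxE.
- exact: integrable_AMGM_weight.
- move=> s i j sab; apply: AMGM_weight_bound => //.
  + exact: measurableD.
  + rewrite (_ : _ \o _ = EFin \o (fun x => \sum_l (qz l).[s] * (wz l).2 x i j)).
      apply: (integrable_rsum mOmega) => l.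
      exact: (integrableZl mOmega _ (wz_integrable l i j)).
    apply/funext => x; rewrite /= summxE; congr (_%:E).
    by apply: eq_bigr => l _; rewrite mxE.
  + by move=> x; rewrite -sobolev_sum2E -zE// sqr_entry_frob.
- move=> s sab; rewrite /phi_conv /L2dot; apply: eq_Rintegral => x _.
  by rewrite (value_polyE vE)// zE// sobolev_sum2E.
Qed.

Let sym_poly (x : E) i j : {poly R} :=
  2^-1 *: (grad_poly qv wv x i j + grad_poly qv wv x j i).

Let symgradE s x : a < s <= b ->
  symgrad (v s) x = \matrix_(i, j) (sym_poly x i j).[s].
Proof.
move=> sab; rewrite /symgrad (grad_polyE vE)//; apply/matrixP => i j.
by rewrite !mxE hornerZ hornerD.
Qed.

Let measurable_sym_poly s i j : measurable_fun Omega
  (fun x : 'rV[measurableTypeR R]_d => (sym_poly x i j).[s] : measurableTypeR R).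
Proof.
rewrite (_ : (fun _ => _) = fun x => 2^-1 *
    ((grad_poly qv wv x i j).[s] + (grad_poly qv wv x j i).[s])); last first.
  by apply/funext => x; rewrite hornerZ hornerD.
apply: measurable_funM; first exact: measurable_cst.
by apply: measurable_funD; exact: measurable_grad_poly.
Qed.

(** The bound on the stress enters as a hypothesis, so that a single [C], chosen before the grid,
    can serve all steps. *)
Lemma visc_quadrature_error (p nuinf nu delta C : R) : 0 <= C ->
  (forall e : 'I_d -> 'I_d -> {poly R},
    (forall i j, (size (e i j) <= k.+1)%N) ->
    (forall i j l s, (l <= k)%N -> a <= s <= b -> `|(e i j)^`(l).[s]| <= A) ->
    forall i j, derivs_bounded a b C k.+1
      (fun s => stress p nuinf nu delta (\matrix_(i, j) (e i j).[s]) i j)) ->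
  `|\int[leb]_(s in `]a, b]) phi_visc Omega p nuinf nu delta v z s -
     quadrature xi om (phi_visc Omega p nuinf nu delta v z)|
  <= (d * d)%:R * (C * (b - a) ^+ k.+1 *
       \int[leb]_(s in `]a, b]) AMGM_weight s).
Proof.
move=> C0 CP.
have [N [mN N0 NP]] := null_complement (ae_derivn_bounded ab vE vA).
have symzE s x : \sum_l (qz l).[s] *: symgrad (wz l) x =
    2^-1 *: (\sum_l (qz l).[s] *: (wz l).2 x + (\sum_l (qz l).[s] *: (wz l).2 x)^T).
  rewrite linear_sum /= -big_split scaler_sumr; apply: eq_bigr => l _.
  by apply/matrixP => i j; rewrite !mxE; ring.
have symz_integrable l i j : mu.-integrable Omega (fun x => (symgrad (wz l) x i j)%:E).
  have := integrableZl mOmega 2^-1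
    (integrableD mOmega (wz_integrable l i j) (wz_integrable l j i)).
  by apply: eq_integrable => // x _; rewrite /= !mxE.
apply: (@quadrature_matrix_pairing_error _ _ R mu Omega N mOmega mN N0 a b C d k mz ab C0
  (fun s x => stress p nuinf nu delta (\matrix_(i, j) (sym_poly x i j).[s]))
  qz (fun l x => symgrad (wz l) x)) => //.
- move=> x i j /NP H; apply: CP => [i' j'|i' j' l s lk sab].
    rewrite (leq_trans (size_scale_leq _ _))// (leq_trans (size_polyD _ _))//.
    by rewrite geq_max !size_grad_poly.
  (* Symmetrization averages two entries and therefore keeps the bound [A]. *)
  rewrite derivnZ derivnD hornerZ hornerD normrM ger0_norm//.
  have [_ Hg] := H l s lk sab.
  have h1 := Hg i' j'; have h2 := Hg j' i'.
  have := ler_normD (grad_poly qv wv x i' j')^`(l).[s] (grad_poly qv wv x j' i')^`(l).[s].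
  lra.
- move=> s i j.
  rewrite (_ : (fun _ => _) = (fun x => (nuinf + nu * (delta ^+ 2 +
      \sum_i \sum_j (sym_poly x i j).[s] ^+ 2) `^ ((p - 2) / 2)) *
      (sym_poly x i j).[s])); last first.
    apply/funext => x; rewrite /stress mxE mxE sqr_frob.
    rewrite (_ : mxinner _ _ = \sum_i \sum_j (sym_poly x i j).[s] ^+ 2)//.
    by apply: eq_bigr => i' _; apply: eq_bigr => j' _; rewrite !mxE expr2.
  have mg : @measurable_fun _ _ 'rV[measurableTypeR R]_d (measurableTypeR R) Omega
      (fun x => delta ^+ 2 + \sum_i \sum_j (sym_poly x i j).[s] ^+ 2).
    apply: measurable_funD; first exact: measurable_cst.
    apply: measurable_sum => i'; apply: measurable_sum => j'.
    by apply: measurable_funX; exact: measurable_sym_poly.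
  apply: measurable_funM; last exact: measurable_sym_poly.
  apply: measurable_funD; first exact: measurable_cst.
  apply: measurable_funM; first exact: measurable_cst.
  exact: (measurableT_comp (measurable_powR _) mg).
- exact: integrable_AMGM_weight.
- move=> s i j sab; apply: AMGM_weight_bound => //.
  + exact: measurableD.
  + rewrite (_ : _ \o _ = EFin \o (fun x => \sum_l (qz l).[s] * symgrad (wz l) x i j)).
      apply: (integrable_rsum mOmega) => l.
      exact: (integrableZl mOmega _ (symz_integrable l i j)).
    apply/funext => x; rewrite /= summxE; congr (_%:E).
    by apply: eq_bigr => l _; rewrite mxE.
  (* By convexity the square of the average of two entries is at most the average of their
     squares. *)
  + move=> x; rewrite symzE -sobolev_sum2E -zE// !mxE.
    have h1 := sqr_entry_frob ((z s).2 x) i j.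
    have h2 := sqr_entry_frob ((z s).2 x) j i.
    move: h1 h2; set u := (z s).2 x i j; set u' := (z s).2 x j i => h1 h2.
    have := sqr_ge0 (u - u'); nra.
- move=> s sab; rewrite /phi_visc /L2dot; apply: eq_Rintegral => x _.
  rewrite symgradE//; congr (mxinner _ _).
  by rewrite symzE /symgrad zE// sobolev_sum2E.
Qed.

End consistency_error.

Lemma integrable_setU d (X : measurableType d) (R : realType)
    (mu : {measure set X -> \bar R}) (A B : set X) (f : X -> \bar R) :
  measurable A -> measurable B -> [disjoint A & B] ->
  mu.-integrable A f -> mu.-integrable B f -> mu.-integrable (A `|` B) f.
Proof.
move=> mA mB AB /integrableP[mfA fA] /integrableP[mfB fB].
have mfAB : measurable_fun (A `|` B) f by apply/measurable_funU.
apply/integrableP; split => //; rewrite ge0_integral_setU//.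
  exact: lte_add_pinfty.
exact: measurableT_comp.
Qed.

(** * Summation over the time steps *)

Section time_grid.
Context {R : realType}.
Local Notation leb := (@lebesgue_measure R).
Variables (N : nat) (t : nat -> R).
Hypothesis tS : forall n, (n < N)%N -> t n < t n.+1.

Lemma grid_le i j : (i <= j)%N -> (j <= N)%N -> t i <= t j.
Proof.
move=> /subnKC <-; elim: (j - i)%N => [|l IH]; first by rewrite addn0.
rewrite addnS => lN; rewrite (le_trans (IH (ltnW lN)))//.
by rewrite ltW// tS.
Qed.

Lemma Rintegral_grid (f : R -> R) :
  (forall n, (n < N)%N -> leb.-integrable `]t n, t n.+1] (EFin \o f)) ->
  leb.-integrable `]t 0%N, t N] (EFin \o f) /\
  \int[leb]_(s in `]t 0%N, t N]) f s =
    \sum_(n < N) \int[leb]_(s in `]t n, t n.+1]) f s.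
Proof.
move=> fi; suff H l : (l <= N)%N -> leb.-integrable `]t 0%N, t l] (EFin \o f) /\
    \int[leb]_(s in `]t 0%N, t l]) f s =
      \sum_(n < l) \int[leb]_(s in `]t n, t n.+1]) f s by exact: H.
elim: l => [_|l IH lN].
  rewrite big_ord0 set_itvoc0; split; first exact: integrable_set0.
  by rewrite Rintegral_set0.
have [i1 i2] := IH (ltnW lN).
have dis : [disjoint `]t 0%N, t l]%classic & `]t l, t l.+1]%classic].
  apply/disj_setPS => s [] /=; rewrite !in_itv /= => /andP[_ sl] /andP[ls _].
  by move: (lt_le_trans ls sl); rewrite ltxx.
have E : `]t 0%N, t l.+1]%classic = `]t 0%N, t l]%classic `|` `]t l, t l.+1]%classic.
  rewrite -itv_bndbnd_setU// bnd_simp; first exact: grid_le (leq0n _) (ltnW lN).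
  by rewrite ltW// tS.
rewrite E; have U : leb.-integrable (`]t 0%N, t l] `|` `]t l, t l.+1]) (EFin \o f).
  by apply: integrable_setU => //; exact: fi.
split => //; rewrite Rintegral_setU// big_ord_recr /= i2//.
Qed.

End time_grid.

(** For positive [L] take [lambda = L]; it is not the minimizer, but the loss depends only on [m],
    which is fixed data. For [L = 0] let lambda tend to 0. *)
Lemma AMGM_optimize (R : realType) (x K m L : R) : 0 <= K -> 0 <= m -> 0 <= L ->
  (forall lambda, 0 < lambda -> x <= K * ((lambda * m + L ^+ 2 / lambda) / 2)) ->
  x <= K * ((m + 1) / 2) * L.
Proof.
move=> K0 m0; rewrite le_eqVlt => /predU1P[<-|L0] H; last first.
  apply: le_trans (H L L0) _; rewrite le_eqVlt; apply/orP; left; apply/eqP.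
  by field; rewrite gt_eqF.
rewrite mulr0; apply/ler_addgt0Pr => e e0; rewrite add0r.
have Km : 0 < K * m + 1 by rewrite ltr_wpDl// mulr_ge0.
have := H (e / (K * m + 1)); rewrite divr_gt0// => /(_ isT) /le_trans; apply.
have -> : K * ((e / (K * m + 1) * m + 0 ^+ 2 / (e / (K * m + 1))) / 2) =
    e * (K * m) / (2 * (K * m + 1)).
  by rewrite expr0n mul0r addr0; field; rewrite gt_eqF.
rewrite ler_pdivrMr ?mulr_gt0// ler_wpM2l ?ltW//.
by have := mulr_ge0 K0 m0; lra.
Qed.

Theorem lemmaA4 (R : realType) (d : nat) (hd : d = 2%N \/ d = 3%N)
    (Omega : set 'rV[R]_d) (hOmega : lipschitz_domain Omega)
    (T : R) (hT : 0 < T) (nu : R) (hnu : 0 < nu) (k : nat)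
    (A p nuinf delta : R) (hp : 1 < p < 2) (hnuinf : 0 <= nuinf)
    (hdelta : 0 < delta) :
  exists B : R,
    forall (N : nat) (t : nat -> R) (ht : time_grid T N t)
      (M : nat) (K : 'I_M -> set 'rV[R]_d) (hK : mesh Omega K)
      (sigma : R) (hsigma : shape_regular sigma K)
      (r : nat) (Vh : set (sobolev_pair R d))
      (hVh : conforming_fe_space Omega r K Vh)
      (xi om : nat -> 'I_k.+1 -> R)
      (hGR : forall n, (n < N)%N ->
        gauss_radau (t n) (t n.+1) (xi n) (om n))
      (v : R -> sobolev_pair R d) (hv : Ytau_tensor k N t Vh v)
      (hA : (\big[maxe/0%E]_(l < k.+1) \big[maxe/0%E]_(n < N)
        LinfW1infnorm Omega `]t n, t n.+1] (dtime l v) <= A%:E)%E)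
      (z : R -> sobolev_pair R d) (hz : Ytau_tensor k N t Vh z),
      `| \sum_(n < N) quad_error t xi om (phi_conv Omega v z) n |
      + `| \sum_(n < N)
             quad_error t xi om (phi_visc Omega p nuinf nu delta v z) n |
      <= B * max_step N t ^+ k.+1 * L2H1norm Omega `]0, T[ z.
Proof.
have [oOmega _ _ bOmega _] := hOmega.
have Omegaoo := bounded_measure_lty oOmega bOmega.
(* [B] is chosen before [A] is known to dominate a norm, so [A] may be negative at this point. *)
pose A0 := Num.max A 0.
have A00 : 0 <= A0 by rewrite le_max lexx orbT.
have p2 : p < 2 by case/andP: hp.
have [C2 C20 C2P] := derivs_bounded_stress d k k.+1 nuinf nu p2 hdelta A00.
pose C1 := 2 ^+ k.+1 * (A0 * A0).
have C10 : 0 <= C1 by rewrite !mulr_ge0// exprn_ge0.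
(* The measure of the space-time cylinder, which appears when [lambda * |Omega|] is integrated over
   the time interval. *)
pose m := fine (lebesgue_rV R d Omega) * T.
have m0 : 0 <= m by rewrite mulr_ge0 ?fine_ge0// ltW.
pose K0 := (d * d)%:R * (C1 + C2).
have K00 : 0 <= K0 by rewrite mulr_ge0// addr_ge0.
exists (K0 * ((m + 1) / 2)) => N t ht M K hK sigma hsigma r Vh hVh xi om hGR v hv hA z hz.
have [t0 tN tS] := ht.
have [VhH1 _ _ _] := hVh.
have tau0 : 0 <= max_step N t by exact: bigmax_ge_id.
rewrite (_ : _ * L2H1norm _ _ _ = K0 * max_step N t ^+ k.+1 * ((m + 1) / 2) *
  L2H1norm Omega `]0, T[ z); last by ring.
apply: AMGM_optimize => //.
- by rewrite mulr_ge0// exprn_ge0.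
- exact: sqrtr_ge0.
move=> lambda lambda0.
have [mv [yv [wv [yvY wvV vE]]]] := hv.
have [mz [yz [wz [yzY wzV zE]]]] := hz.
have step n : (n < N)%N ->
    [/\ (@lebesgue_measure R).-integrable `]t n, t n.+1]
          (EFin \o AMGM_weight Omega z lambda),
        (@lebesgue_measure R).-integrable `]t n, t n.+1]
          (EFin \o (fun s => H1norm Omega (z s) ^+ 2)) &
        `|quad_error t xi om (phi_conv Omega v z) n| +
        `|quad_error t xi om (phi_visc Omega p nuinf nu delta v z) n| <=
        K0 * max_step N t ^+ k.+1 *
          \int[@lebesgue_measure R]_(s in `]t n, t n.+1]) AMGM_weight Omega z lambda s].
  move=> nN; have ab := tS _ nN.
  have inI s : t n < s <= t n.+1 -> t 0%N < s <= t N.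
    move=> /andP[ns sn]; rewrite (le_lt_trans _ ns) ?(le_trans sn)//.
    + exact: (grid_le tS).
    + exact: (grid_le tS (leq0n n) (ltnW nN)).
  have /choice[qv qvP] : forall i, exists q : {poly R}, (size q <= k.+1)%N /\
      forall s, t n < s <= t n.+1 -> yv i s = q.[s].
    by move=> i; have [q] := yvY i n nN; exists q.
  have /choice[qz qzP] : forall i, exists q : {poly R}, (size q <= k.+1)%N /\
      forall s, t n < s <= t n.+1 -> yz i s = q.[s].
    by move=> i; have [q] := yzY i n nN; exists q.
  have sqv l := (qvP l).1; have sqz l := (qzP l).1.
  have wvH1 l : H1 Omega (wv l) := VhH1 _ (wvV l).
  have wzH1 l : H1 Omega (wz l) := VhH1 _ (wzV l).
  have vqE s : t n < s <= t n.+1 -> v s = \sum_l (qv l).[s] *: wv l.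
    move=> sI; rewrite vE ?inI//; apply: eq_bigr => l _.
    by rewrite (qvP l).2.
  have zqE s : t n < s <= t n.+1 -> z s = \sum_l (qz l).[s] *: wz l.
    move=> sI; rewrite zE ?inI//; apply: eq_bigr => l _.
    by rewrite (qzP l).2.
  have vA l : (l <= k)%N ->
      (LinfW1infnorm Omega `]t n, t n.+1] (dtime l v) <= A0%:E)%E.
    move=> lk; apply: (@le_trans _ _ A%:E); last by rewrite lee_fin le_max lexx.
    apply: le_trans hA.
    apply: le_trans (le_bigmax _ _ (Ordinal (lk : (l < k.+1)%N))) => /=.
    exact: (le_bigmax _ (fun n : 'I_N =>
      LinfW1infnorm Omega `]t n, t n.+1] (dtime l v)) (Ordinal nN)).
  have hi := integrable_AMGM_weight oOmega ab wzH1 zqE lambda0.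
  split => //; first exact: (integrable_sqr_H1norm oOmega wzH1 zqE).
  have e1 := conv_quadrature_error oOmega Omegaoo ab sqv sqz wvH1 wzH1 vqE zqE
    (hGR n nN) A00 lambda0 vA.
  have e2 := visc_quadrature_error oOmega Omegaoo ab sqv sqz wvH1 wzH1 vqE zqE
    (hGR n nN) lambda0 vA C20 (C2P (t n) (t n.+1)).
  rewrite /quad_error (le_trans (lerD e1 e2))// -/C1.
  have w0 : 0 <= \int[@lebesgue_measure R]_(s in `]t n, t n.+1]) AMGM_weight Omega z lambda s.
    apply: Rintegral_ge0 => s _; rewrite divr_ge0// addr_ge0//.
      by rewrite mulr_ge0 ?fine_ge0// ltW.
    by rewrite divr_ge0 ?sqr_ge0// ltW.
  rewrite -!mulrDr -!mulrDl /K0 -!mulrA ler_wpM2l// ler_wpM2l ?addr_ge0//.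
  rewrite ler_wpM2r// lerXn2r// ?nnegrE ?subr_ge0//; first exact: ltW.
  exact: (le_bigmax _ (fun n : 'I_N => t n.+1 - t n) (Ordinal nN)).
apply: (@le_trans _ _ (\sum_(n < N)
    (`|quad_error t xi om (phi_conv Omega v z) n| +
     `|quad_error t xi om (phi_visc Omega p nuinf nu delta v z) n|))).
  by rewrite [leRHS]big_split /= lerD//; exact: ler_norm_sum.
apply: (@le_trans _ _ (\sum_(n < N) (K0 * max_step N t ^+ k.+1 *
    \int[@lebesgue_measure R]_(s in `]t n, t n.+1]) AMGM_weight Omega z lambda s))).
  by apply: ler_sum => n _; have [] := step n (ltn_ord n).
rewrite -mulr_sumr ler_wpM2l//; first by rewrite mulr_ge0// exprn_ge0.
have [_ hE] := Rintegral_grid tS (fun n nN => let: And3 h _ _ := step n nN in h).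
have [Hi _] := Rintegral_grid tS (fun n nN => let: And3 _ h _ := step n nN in h).
rewrite -hE sqr_sqrtr; last by apply: Rintegral_ge0 => s _; exact: sqr_ge0.
rewrite t0 tN in Hi *.
have mI : @measurable _ (measurableTypeR R) `]0, T] by [].
have Hoo : (@lebesgue_measure R).-integrable `]0, T[
    (EFin \o (fun s => H1norm Omega (z s) ^+ 2)).
  apply: integrableS Hi => // s.
  by rewrite /= !in_itv /= => /andP[-> /ltW ->].
have ci : (@lebesgue_measure R).-integrable `]0, T]
    (EFin \o cst (lambda * fine (lebesgue_rV R d Omega) / 2)).
  apply: measurable_bounded_integrable => //.
    by rewrite /= lebesgue_measure_itv /= lte_fin hT -EFinB ltry.
  exists `|lambda * fine (lebesgue_rV R d Omega) / 2|.
  by split; [exact: num_real|move=> y /ltW + x _].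
(* The norm of [z] is taken over the open interval, whereas the half-open steps fill []0, T]]. *)
rewrite (Rintegral_itv_bndo_bndc Hoo).
have -> : \int[@lebesgue_measure R]_(s in `]0, T]) AMGM_weight Omega z lambda s =
    \int[@lebesgue_measure R]_(s in `]0, T])
      (cst (lambda * fine (lebesgue_rV R d Omega) / 2) s +
       (2 * lambda)^-1 * H1norm Omega (z s) ^+ 2).
  by apply: eq_Rintegral => s _; rewrite /AMGM_weight /=; field; rewrite gt_eqF.
rewrite RintegralD//; last exact: (integrableZl mI _ Hi).
rewrite Rintegral_cst// RintegralZl// /= lebesgue_measure_itv /= lte_fin hT -EFinB subr0 /m /=.
rewrite le_eqVlt; apply/orP; left; apply/eqP.
by field; rewrite gt_eqF.
Qed.
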